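(* Let $n\ge 1$, let $f\in\mathcal{S}(\mathbb{R}^n)$, let $x\in\mathbb{R}^n$ and let $0<s\le n/2$. In the case $s=n/2$ assume in addition that $\int_{\mathbb{R}^n}f(z)\,dz=0$. Then $$(-\Delta)^{-s}f(x)=\int_{\mathbb{R}^n}K_{-s}(x-z)f(z)\,dz,$$ where, for $x\neq 0$, $$K_{-s}(x)=\begin{cases}\displaystyle c_{n,-s}\,\frac{1}{|x|^{n-2s}}&\text{if }0<s<n/2,\\[2mm] \displaystyle\frac{1}{\Gamma(n/2)(4\pi)^{n/2}}\big(-2\log|x|-\gamma\big)&\text{if }s=n/2,\end{cases}$$ with $$c_{n,-s}=\frac{\Gamma(n/2-s)}{4^s\Gamma(s)\pi^{n/2}}\quad\text{for }0<s<n/2,$$ and $\gamma=-\int_0^\infty e^{-r}\log r\,dr$ the Euler--Mascheroni constant.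
   Context: $\mathcal{S}(\mathbb{R}^n)$ is the Schwartz class. The Fourier transform is normalized so that $\widehat{(-\Delta)u}(\xi)=|\xi|^2\widehat{u}(\xi)$. For $s>0$ and $f\in\mathcal{S}(\mathbb{R}^n)$ the inverse fractional Laplacian (negative power of the Laplacian) is defined by $\widehat{(-\Delta)^{-s}f}(\xi)=|\xi|^{-2s}\widehat{f}(\xi)$ for $\xi\ne0$; equivalently, inverting the Fourier transform, it is given pointwise by the semigroup formula $$(-\Delta)^{-s}f(x)=\frac{1}{\Gamma(s)}\int_0^\infty e^{t\Delta}f(x)\,\frac{dt}{t^{1-s}},$$ where $e^{t\Delta}$ is the heat semigroup, $e^{t\Delta}f(x)=\int_{\mathbb{R}^n}G_t(x-z)f(z)\,dz$ with $G_t(x)=(4\pi t)^{-n/2}e^{-|x|^2/(4t)}$, $t>0$. *)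

(* Defs.v *)
From HB Require Import structures.
From mathcomp Require Import all_boot all_order all_algebra.
From mathcomp Require Import all_classical all_reals all_analysis.
From mathcomp Require Import complex.

Set Implicit Arguments.
Unset Strict Implicit.
Unset Printing Implicit Defensive.

Import Order.TTheory GRing.Theory Num.Theory.
Import numFieldNormedType.Exports.

Local Open Scope classical_set_scope.
Local Open Scope ring_scope.
Local Open Scope complex_scope.

Definition cons_pair (T : Type) n (p : T * n.-tuple T) : n.+1.-tuple T :=
  [tuple of p.1 :: p.2].

Lemma measurable_cons_pair d (T : measurableType d) n :
  measurable_fun setT (@cons_pair T n).
Proof. exact: measurable_cons. Qed.

Section tuple_measureS.
Context d (T : measurableType d) (R : realType) (n : nat).
Variables (m1 : {sigma_finite_measure set T -> \bar R})
          (m2 : {sigma_finite_measure set (n.-tuple T) -> \bar R}).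

(* Product of a measure on T and a measure on T^n, transported to T^(n+1). *)
Definition tuple_measureS : set (n.+1.-tuple T) -> \bar R :=
  pushforward (m1 \x m2)%E (@cons_pair T n).

Let tuple_measureS0 : tuple_measureS set0 = 0%E.
Proof. by rewrite /tuple_measureS /pushforward preimage_set0 measure0. Qed.

Let tuple_measureS_ge0 A : (0 <= tuple_measureS A)%E.
Proof. by rewrite /tuple_measureS /pushforward; exact: measure_ge0. Qed.

Let preim A : measurable A -> measurable (@cons_pair T n @^-1` A).
Proof.
by move=> mA; rewrite -[X in measurable X]setTI; exact: measurable_cons_pair.
Qed.

Let tuple_measureS_sigma_additive : semi_sigma_additive tuple_measureS.
Proof.
move=> F mF tF mUF; rewrite /tuple_measureS /pushforward preimage_bigcup.
apply: measure_semi_sigma_additive.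
- by move=> i; exact: preim.
- apply/trivIsetP => /= i j _ _ ij; rewrite -preimage_setI.
  by move/trivIsetP : tF => /(_ _ _ _ _ ij) ->//; rewrite preimage_set0.
- by rewrite -preimage_bigcup; exact: preim.
Qed.

HB.instance Definition _ := isMeasure.Build _ _ _ tuple_measureS
  tuple_measureS0 tuple_measureS_ge0 tuple_measureS_sigma_additive.

Let tuple_measureS_sigma_finite : sigma_finite setT tuple_measureS.
Proof.
have [F TF Foo] : sigma_finite setT (m1 \x m2)%E.
  have /sigma_finiteP[F [TF ndF Foo]] := sigma_finiteT m1.
  have /sigma_finiteP[G [TG ndG Goo]] := sigma_finiteT m2.
  exists (fun k => F k `*` G k).
    rewrite -setXTT TF TG predeqE => -[x y]; split.
      move=> [/= [k _ Fkx] [l _ Gly]]; exists (maxn k l) => //; split.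
      - by move: x Fkx; exact/subsetPset/ndF/leq_maxl.
      - by move: y Gly; exact/subsetPset/ndG/leq_maxr.
    by move=> [k _ []/= ? ?]; split; exists k.
  move=> k; have [? ?] := Foo k; have [? ?] := Goo k.
  split; first exact: measurableX.
  by rewrite product_measure1E// lte_mul_pinfty// ge0_fin_numE.
pose g (t : n.+1.-tuple T) : T * n.-tuple T := (thead t, [tuple of behead t]).
have gK p : g (cons_pair p) = p.
  by case: p => a b; rewrite /g /cons_pair/= theadE; congr pair; apply/val_inj.
have mg : measurable_fun setT g.
  apply: measurable_fun_pair => /=; first exact: measurable_tnth.
  exact: measurable_behead.
exists (fun k => g @^-1` F k).
  by rewrite -preimage_bigcup -TF preimage_setT.
move=> k; have [mFk Fkoo] := Foo k; split.
  by rewrite -[X in measurable X]setTI; exact: mg.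
rewrite /tuple_measureS /pushforward.
suff -> : @cons_pair T n @^-1` (g @^-1` F k) = F k by [].
by apply/seteqP; split => p /=; rewrite gK.
Qed.

HB.instance Definition _ := Measure_isSigmaFinite.Build _ _ _ tuple_measureS
  tuple_measureS_sigma_finite.

End tuple_measureS.

Definition tuple_measure d (T : measurableType d) (R : realType)
    (m : {sigma_finite_measure set T -> \bar R}) :=
  fix loop (n : nat) : {sigma_finite_measure set (n.-tuple T) -> \bar R} :=
    match n with
    | 0 => \d_([tuple] : 0.-tuple T)
    | k.+1 => tuple_measureS m (loop k)
    end.

Local Notation Re := (@complex.Re _).
Local Notation Im := (@complex.Im _).

Section euclidean.
Variables (R : realType) (n : nat).
Implicit Types (f g : 'rV[R]_n -> R[i]) (x xi : 'rV[R]_n).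

Definition dotp x xi : R := \sum_i x 0 i * xi 0 i.

(* The library norm on 'rV[R]_n is the sup norm. *)
Definition enorm x : R := Num.sqrt (dotp x x).

(* Lebesgue measure lives on n.-tuple R, which carries the product
   sigma-algebra; functions on 'rV[R]_n are integrated through row_of_tuple. *)
Definition lebesgue_tuple := tuple_measure (@lebesgue_measure R) n.

Definition row_of_tuple (t : n.-tuple (measurableTypeR R)) : 'rV[R]_n :=
  \row_i (tnth t i : R).

Definition integrable_Rn g : Prop :=
  lebesgue_tuple.-integrable setT (fun t => (Re (g (row_of_tuple t)))%:E) /\
  lebesgue_tuple.-integrable setT (fun t => (Im (g (row_of_tuple t)))%:E).

Definition integral_Rn g : R[i] :=
  (\int[lebesgue_tuple]_t Re (g (row_of_tuple t))) +i*
  (\int[lebesgue_tuple]_t Im (g (row_of_tuple t))).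

Definition partial_derivable (i : 'I_n) f x : Prop :=
  derivable (Re \o f) x (delta_mx 0 i) /\ derivable (Im \o f) x (delta_mx 0 i).

Definition partial_derive (i : 'I_n) f x : R[i] :=
  'D_(delta_mx 0 i) (Re \o f) x +i* 'D_(delta_mx 0 i) (Im \o f) x.

(* Iterated partial derivatives, in the order prescribed by the list. *)
Definition partials (beta : seq 'I_n) f : 'rV[R]_n -> R[i] :=
  foldr partial_derive f beta.

Definition smooth f : Prop := forall beta : seq 'I_n,
  [/\ continuous (Re \o partials beta f), continuous (Im \o partials beta f) &
      forall i x, partial_derivable i (partials beta f) x].

Definition monomial (alpha : 'I_n -> nat) x : R := \prod_i x 0 i ^+ alpha i.

Definition schwartz f : Prop :=
  smooth f /\
  forall (alpha : 'I_n -> nat) (beta : seq 'I_n), exists M : R,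
    forall x, `|monomial alpha x| * Normc.normc (partials beta f x) <= M.

(* exp (i t) *)
Definition expi (t : R) : R[i] := cos t +i* sin t.

Definition fourier f xi : R[i] :=
  ((2 * pi) `^ (- (n%:R / 2)))%:C *
  integral_Rn (fun x => expi (- dotp x xi) * f x).

Definition inverse_fourier g x : R[i] :=
  ((2 * pi) `^ (- (n%:R / 2)))%:C *
  integral_Rn (fun xi => expi (dotp x xi) * g xi).

(* The operator with Fourier multiplier |xi|^(-2s), evaluated pointwise; the
   value of the multiplier at the single point xi = 0 plays no role. *)
Definition inv_frac_laplacian (s : R) f : 'rV[R]_n -> R[i] :=
  inverse_fourier (fun xi => (enorm xi `^ (- (2 * s)))%:C * fourier f xi).

End euclidean.

Definition Gamma (R : realType) (s : R) : R :=
  \int[lebesgue_measure]_(r in `]0, +oo[) (expR (- r) * r `^ (s - 1)).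

Definition euler_gamma (R : realType) : R :=
  - \int[lebesgue_measure]_(r in `]0, +oo[) (expR (- r) * ln r).

Definition c_const (R : realType) (n : nat) (s : R) : R :=
  Gamma (n%:R / 2 - s) / (4 `^ s * Gamma s * pi `^ (n%:R / 2)).

(* Only meaningful for x != 0 and 0 < s <= n / 2: the value at x = 0 is an
   artefact of the totalized inverse and logarithm. *)
Definition kernel_K (R : realType) (n : nat) (s : R) (x : 'rV[R]_n) : R :=
  if s < n%:R / 2 then c_const n s * (1 / enorm x `^ (n%:R - 2 * s))
  else 1 / (Gamma (n%:R / 2) * (4 * pi) `^ (n%:R / 2)) *
       (- 2 * ln (enorm x) - euler_gamma R).

(* Main.v *)
From HB Require Import structures.
Require Import Defs.
From mathcomp Require Import all_boot all_order all_algebra.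
From mathcomp Require Import all_classical all_reals all_analysis.
From mathcomp Require Import measurable_realfun complex ring lra.

(** Why the formula holds.  For q > 0 the Gamma integral, written in the
    logarithmic time t = exp u, is
      Gamma s * q^(-s) = \int_R exp (s u - q exp u) du,
    so that scaling in q is a translation in u and t -> 1/t is u -> -u.  With
    q = |xi|^2 it turns the multiplier |xi|^(-2s) into a superposition of heat
    multipliers exp (- exp u |xi|^2); the Fourier transform of a Gaussian turns
    each of them into a heat kernel acting on f; and the u-integral of the heat
    kernels, now with q = |x - z|^2 / 4 and u -> -u, is again a Gamma integral,
    whose value is the Riesz kernel.

    If s = n/2 the last integral diverges logarithmically.  As f has mean
    zero, the indicator of u > 0 may be subtracted from the heat kernel first,
    and the integral of exp (- q exp (- u)) - 1_{u > 0} converges to a constant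
    minus ln q (integral_log_heat).  The value of the constant, hence of the
    Euler constant in the kernel, is irrelevant because f has mean zero.

    All computations are done on real functions g (the real and imaginary parts
    of f), with phase_ft x a g xi = \int cos ((x - z).xi + a) g(z) dz; the phase
    a covers the real and the imaginary part of exp (i (x - z).xi) together.
    The real statement is riesz_representation.

    The exchanges of integrals rest on absolute convergence, and every
    estimate is made against the product weight w(x) = \prod_i 1/(1 + x_i^2),
    whose integral is a product of one-dimensional ones.  A Schwartz function
    and its phase_ft are bounded by C w^2 (rschwartz_rapid, rapid_phase_ft),
    the second because an integration by parts trades a coordinate xi_i for a
    partial derivative (phase_ft_partial); this integration by parts is the
    vanishing of the integral of a directional derivative
    (Rintegral_directional_derive0), a consequence of translation invariance.
    The singularity is handled by integrable_enorm_weight: |x - z|^(-a) w(z) is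
    integrable for 0 < a < n.  When s = n/2 the mean-zero condition gives
    |phase_ft x a g xi| <= C |xi| (phase_ft_lipschitz), which compensates the
    non-integrable singularity |xi|^(-n). *)

Set Implicit Arguments.
Unset Strict Implicit.
Unset Printing Implicit Defensive.

Import Order.TTheory GRing.Theory Num.Theory.
Import numFieldNormedType.Exports.

Local Open Scope classical_set_scope.
Local Open Scope ring_scope.

(** * Translations and reflections of the line *)
Section line_invariance.
Context {R : realType}.
Local Notation leb := (@lebesgue_measure R).

Let shiftR (a : R) : measurableTypeR R -> measurableTypeR R := fun x => x + a.

Let measurable_shiftR a : measurable_fun setT (shiftR a).
Proof. exact: measurable_funD. Qed.

Let pushforward_shiftR (a : R) (A : set R) : measurable A ->
  pushforward leb (shiftR a) A = leb A.
Proof.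
pose mphi := isMeasurableFun.Build _ _ _ _ _ (measurable_shiftR a).
pose phi : {mfun measurableTypeR R >-> measurableTypeR R} :=
  HB.pack (shiftR a) mphi.
move=> mA; apply/esym.
apply: (@lebesgue_measure_unique R (pushforward leb phi)) => //= _ [[b c]] _ <-.
rewrite /pushforward (_ : _ @^-1` _ = [set` `]b - a, c - a]]); last first.
  by apply/seteqP; split => x /=; rewrite !in_itv/= ltrBlDr lerBrDr.
rewrite !lebesgue_measure_itv/= !lte_fin ltrD2r.
by case: ifP => // _; rewrite -!EFinB; congr EFin; ring.
Qed.

Lemma ge0_integral_shift (a : R) (f : R -> \bar R) :
  measurable_fun [set: R] f -> (forall x, (0 <= f x)%E) ->
  (\int[leb]_x f (x + a)%R = \int[leb]_x f x)%E.
Proof.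
move=> mf f0; transitivity (\int[pushforward leb (shiftR a)]_x f x)%E.
  by rewrite ge0_integral_pushforward//=; exact: measurable_shiftR.
by apply: eq_measure_integral => A mA _; exact: pushforward_shiftR.
Qed.

Lemma ge0_integral_opp (f : R -> \bar R) :
  measurable_fun [set: R] f -> (forall x, (0 <= f x)%E) ->
  (\int[leb]_x f (- x)%R = \int[leb]_x f x)%E.
Proof.
move=> mf f0.
transitivity (\int[pushforward leb (-%R : R -> measurableTypeR R)]_x f x)%E.
  by rewrite ge0_integral_pushforward.
by apply: eq_measure_integral => A mA _; exact: lebesgue_measureN.
Qed.

End line_invariance.

Section integrable_tools.
Context d (T : measurableType d) (R : realType).
Variable mu : {measure set T -> \bar R}.

Lemma integrable_le_norm (f g : T -> R) : measurable_fun setT f ->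
  (forall x, `|f x| <= g x) ->
  mu.-integrable setT (EFin \o g) -> mu.-integrable setT (EFin \o f).
Proof.
move=> mf fg; apply: le_integrable => //; first exact/measurable_EFinP.
move=> x _ /=; rewrite lee_fin (le_trans (fg x))//; exact: ler_norm.
Qed.

Lemma integral_EFin_Rintegral (f : T -> R) :
  mu.-integrable setT (EFin \o f) ->
  (\int[mu]_x (f x)%:E)%E = (\int[mu]_x f x)%:E.
Proof. by move=> fi; rewrite /Rintegral fineK//; exact: integrable_fin_num. Qed.

Lemma Rintegral_EFin (f : T -> R) (c : R) :
  (\int[mu]_x (f x)%:E)%E = c%:E -> \int[mu]_x f x = c.
Proof. by rewrite /Rintegral => ->. Qed.

Lemma ge0_integrable_EFin (f : T -> R) (c : R) : measurable_fun setT f ->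
  (forall x, 0 <= f x) -> (\int[mu]_x (f x)%:E)%E = c%:E ->
  mu.-integrable setT (EFin \o f).
Proof.
move=> mf f0 fc; apply/integrableP; split; first exact/measurable_EFinP.
under eq_integral do rewrite gee0_abs ?lee_fin//.
by rewrite fc ltry.
Qed.

End integrable_tools.

(** * Integration over tuples: products, translations, points *)
Section tuple_integration.
Context {R : realType}.
Local Notation leb := (@lebesgue_measure R).
Local Notation mu n := (lebesgue_tuple R n).
Local Notation T n := (n.-tuple (measurableTypeR R)).

Lemma ge0_integral_tupleS n (f : T n.+1 -> \bar R) :
  measurable_fun setT f -> (forall t, (0 <= f t)%E) ->
  (\int[mu n.+1]_t f t =
   \int[leb]_y \int[mu n]_t f (cons_pair (y, t)))%E.
Proof.
move=> mf f0.
rewrite [LHS]ge0_integral_pushforward//; last exact: measurable_cons_pair.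
rewrite preimage_setT (fubini_tonelli1 (f \o @cons_pair _ n))//.
- by apply: measurableT_comp => //; exact: measurable_cons_pair.
- by move=> p /=.
Qed.

Lemma measurable_tuple_prod n (h : 'I_n -> R -> R) :
  (forall i, measurable_fun setT (h i)) ->
  measurable_fun setT (fun t : T n => \prod_i h i (tnth t i)).
Proof.
move=> mh; apply: measurable_prod => i _.
exact: (measurableT_comp (mh i) (measurable_tnth i)).
Qed.

(** Tonelli for a product of functions of one coordinate each. *)
Lemma ge0_integral_tuple_prod n (h : 'I_n -> R -> R) (c : 'I_n -> R) :
  (forall i, measurable_fun setT (h i)) -> (forall i y, 0 <= h i y) ->
  (forall i, (\int[leb]_y (h i y)%:E)%E = (c i)%:E) ->
  (\int[mu n]_t (\prod_i h i (tnth t i))%:E)%E = (\prod_i c i)%:E.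
Proof.
elim: n h c => [|n IH] h c mh h0 hc.
  rewrite /= integral_dirac//.
    by rewrite diracT mul1e !big_ord0.
  by apply/measurable_EFinP; exact: measurable_tuple_prod.
rewrite ge0_integral_tupleS; last 2 first.
- by apply/measurable_EFinP; exact: measurable_tuple_prod.
- by move=> t; rewrite lee_fin prodr_ge0.
under eq_integral => y _.
  under eq_integral => t _.
    rewrite big_ord_recl (_ : tnth _ ord0 = y)//.
    under eq_bigr => i _ do rewrite (_ : tnth _ (lift ord0 i) = tnth t i) ?tnthS//.
    rewrite EFinM.
    over.
  rewrite ge0_integralZl_EFin//; last 2 first.
  - by move=> t _; rewrite lee_fin prodr_ge0.
  - apply/measurable_EFinP.
    by apply: (@measurable_tuple_prod n (fun i => h (lift ord0 i))).
  rewrite (IH (fun i => h (lift ord0 i)) (fun i => c (lift ord0 i)))//.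
  over.
rewrite ge0_integralZr//; last 3 first.
- exact: (measurableT_comp (@EFin_measurable R setT) (mh ord0)).
- by move=> y _; rewrite lee_fin.
- rewrite lee_fin prodr_ge0// => i _; rewrite -lee_fin -hc.
  by apply: integral_ge0 => y _; rewrite lee_fin.
by rewrite hc -EFinM big_ord_recl.
Qed.

Lemma integrable_tuple_prod n (h : 'I_n -> R -> R) :
  (forall i, measurable_fun setT (h i)) -> (forall i y, 0 <= h i y) ->
  (forall i, leb.-integrable setT (EFin \o h i)) ->
  (mu n).-integrable setT (EFin \o (fun t => \prod_i h i (tnth t i))).
Proof.
move=> mh h0 hi.
apply: (@ge0_integrable_EFin _ _ _ _ _ (\prod_i \int[leb]_y h i y)).
- exact: measurable_tuple_prod.
- by move=> t; rewrite prodr_ge0.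
- by apply: ge0_integral_tuple_prod => // i; rewrite integral_EFin_Rintegral.
Qed.

(** The translation of a tuple by the vector [a]. *)
Definition shift_tuple n (a : 'I_n -> R) (t : T n) : T n :=
  [tuple (tnth t i + a i : R) | i < n].

Lemma measurable_shift_tuple n (a : 'I_n -> R) :
  measurable_fun setT (shift_tuple a).
Proof.
apply/measurable_fun_tnthP => i.
rewrite (_ : _ \o _ = fun t : T n => (tnth t i : R) + a i).
  by apply: measurable_funD => //; exact: measurable_tnth.
by apply/funext => t /=; rewrite tnth_mktuple.
Qed.

Lemma ge0_integral_tuple_shift n (a : 'I_n -> R) (f : T n -> \bar R) :
  measurable_fun setT f -> (forall t, (0 <= f t)%E) ->
  (\int[mu n]_t f (shift_tuple a t) = \int[mu n]_t f t)%E.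
Proof.
elim: n a f => [|n IH] a f mf f0.
  by apply: eq_integral => t _; congr f; apply: eq_from_tnth => -[].
rewrite [LHS]ge0_integral_tupleS//; last first.
  by apply: measurableT_comp => //; exact: measurable_shift_tuple.
rewrite [RHS](ge0_integral_tupleS mf f0).
have mfc : measurable_fun setT (f \o @cons_pair _ n).
  by apply: measurableT_comp => //; exact: measurable_cons_pair.
have fc0 p : (0 <= (f \o @cons_pair _ n) p)%E by exact: f0.
have mg := measurable_fun_fubini_tonelli_F (m2 := mu n) (f \o @cons_pair _ n) mfc fc0.
rewrite -(ge0_integral_shift (a ord0) mg); last first.
  by move=> y; apply: integral_ge0.
apply: eq_integral => y _ /=.
rewrite /fubini_F -[RHS](IH (a \o lift ord0))//; last first.
  by apply: (measurableT_comp mfc); exact: measurable_pair1.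
apply: eq_integral => t _ /=; congr f; apply: eq_from_tnth => i.
rewrite tnth_mktuple; case: (unliftP ord0 i) => [j|] ->.
  by rewrite !tnthS tnth_mktuple.
by rewrite !tnth0.
Qed.

Lemma integral_tuple_shift n (a : 'I_n -> R) (f : T n -> \bar R) :
  measurable_fun setT f ->
  (\int[mu n]_t f (shift_tuple a t) = \int[mu n]_t f t)%E.
Proof.
move=> mf; rewrite integralE [RHS]integralE; congr (_ - _)%E.
- rewrite -[RHS](@ge0_integral_tuple_shift n a f^\+%E (measurable_funepos mf)
    (funepos_ge0 f)).
  by apply: eq_integral => t _; rewrite funepos_comp.
- rewrite -[RHS](@ge0_integral_tuple_shift n a f^\-%E (measurable_funeneg mf)
    (funeneg_ge0 f)).
  by apply: eq_integral => t _; rewrite funeneg_comp.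
Qed.

Lemma lebesgue_tuple_set1 n (a : T n) : (0 < n)%N ->
  measurable [set a] /\ mu n [set a] = 0%E.
Proof.
move=> n0.
have E : [set a] = \bigcap_(i in [set: 'I_n]) ((@tnth n _)^~ i @^-1` [set tnth a i]).
  apply/seteqP; split => [t -> //|t H].
  by apply: eq_from_tnth => i; exact: H.
have mA : measurable [set a].
  rewrite E; apply: fin_bigcap_measurable => // i _.
  by rewrite -[X in measurable X]setTI; apply: measurable_tnth.
split => //.
have -> : mu n [set a] = (\int[mu n]_t (\prod_i \1_[set tnth a i] (tnth t i))%:E)%E.
  rewrite -(setIT [set a]) -integral_indic//; apply: eq_integral => t _.
  congr EFin.
  have [->|ta] := eqVneq t a.
    by rewrite indicE mem_set// big1// => i _; rewrite indicE mem_set.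
  rewrite indicE memNset; last by apply/eqP.
  have [i ti] : exists i, tnth t i != tnth a i.
    apply: contrapT => /forallNP H; move/eqP: ta; apply.
    by apply: eq_from_tnth => i; apply/eqP/negPn/negP/H.
  rewrite (bigD1 i)//= indicE memNset ?mul0r//.
  by apply/eqP.
rewrite (@ge0_integral_tuple_prod _ (fun i => \1_[set tnth a i]) (fun=> 0)).
- by case: n n0 {a E mA} => // n _; rewrite big_ord_recl mul0r.
- by [].
- by move=> i y.
- move=> i; rewrite integral_indic// setIT.
  exact: lebesgue_measure_set1.
Qed.

End tuple_integration.

(** * Measurability of continuous functions on row vectors *)
Section measurability.
Context {R : realType}.
Local Notation T n := (n.-tuple (measurableTypeR R)).

(** [y] rounded down to the grid of mesh 1/(k+1). *)
Let grid (k : nat) (y : R) : R := (Num.floor (y * k.+1%:R))%:~R / k.+1%:R.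

Let grid_dist k y : `|y - grid k y| < k.+1%:R^-1.
Proof.
have k0 : 0 < k.+1%:R :> R by rewrite ltr0n.
have /andP[l u] := floor_itv (y * k.+1%:R).
have -> : y - grid k y
    = (y * k.+1%:R - (Num.floor (y * k.+1%:R))%:~R) / k.+1%:R.
  by rewrite mulrBl mulfK ?gt_eqF.
rewrite normrM normfV (gtr0_norm k0) ltr_pdivrMr// mulVf ?gt_eqF//.
by rewrite ger0_norm ?subr_ge0// ltrBlDl addrC -[1]/(1%:~R) -intrD addrC.
Qed.

(** The sigma-algebra on tuples is the product one, so open sets of row
    vectors are not measurable by definition.  A continuous [f] is the pointwise
    limit of [f] composed with the rounding of all coordinates to a grid, which
    takes countably many values. *)
Lemma measurable_continuous_row n (f : 'rV[R]_n -> R) : continuous f ->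
  measurable_fun setT (f \o @row_of_tuple R n).
Proof.
move=> cf.
pose q k (t : T n) : {ffun 'I_n -> int} :=
  [ffun i => Num.floor ((tnth t i : R) * k.+1%:R)].
pose g k (p : {ffun 'I_n -> int}) : 'rV[R]_n := \row_i ((p i)%:~R / k.+1%:R).
apply: (@measurable_fun_cvg _ _ _ _ (fun k => f \o g k \o q k)) => [k|t _].
  move=> _ Y mY; rewrite setTI.
  have -> : (f \o g k \o q k) @^-1` Y =
      \bigcup_p (if (f (g k p)) \in Y then q k @^-1` [set p] else set0).
    apply/seteqP; split => t /=.
      by move=> Yt; exists (q k t) => //; rewrite mem_set.
    by move=> [p _]; case: ifPn => // /set_mem Yp /= ->.
  apply: countable_bigcupT_measurable => // p; case: ifPn => // _.
  have -> : q k @^-1` [set p] = \bigcap_(i in [set: 'I_n])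
      (@tnth n _ ^~ i @^-1` [set y : measurableTypeR R |
         (p i)%:~R <= (y : R) * k.+1%:R < (p i + 1)%:~R]).
    apply/seteqP; split => t /=.
      by move=> <- i _ /=; rewrite ffunE floor_itv.
    by move=> H; apply/ffunP => i; rewrite ffunE; apply/eqP; rewrite floor_eq H.
  apply: fin_bigcap_measurable => // i _.
  rewrite -[X in measurable X]setTI; apply: measurable_tnth => //.
  have k0 : 0 < k.+1%:R :> R by rewrite ltr0n.
  rewrite (_ : [set _ | _] =
      `[(p i)%:~R / k.+1%:R, (p i + 1)%:~R / k.+1%:R[%classic).
    exact: measurable_itv.
  by apply/seteqP; split => y /=; rewrite in_itv/= ler_pdivrMr// ltr_pdivlMr.
apply: continuous_cvg; first exact: cf.
apply/cvg_ballP => e e0; near=> k; split => // i j.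
rewrite /row_of_tuple /g !mxE ffunE /ball/=.
apply: lt_trans (grid_dist k _) _.
near: k; exact: near_infty_natSinv_lt (PosNum e0).
Unshelve. all: end_near. Qed.

Lemma measurable_coord n (i : 'I_n) :
  measurable_fun setT (fun t : T n => row_of_tuple t 0 i : R).
Proof.
rewrite (_ : (fun _ => _) = fun t : T n => (tnth t i : R)).
  exact: measurable_tnth.
by apply/funext => t; rewrite mxE.
Qed.

End measurability.

(** * Integrals on the line *)
Section line_integrals.
Context {R : realType}.
Local Notation leb := (@lebesgue_measure R).

Lemma integral_shift (a : R) (f : R -> \bar R) :
  measurable_fun [set: R] f ->
  (\int[leb]_x f (x + a)%R = \int[leb]_x f x)%E.
Proof.
move=> mf; rewrite integralE [RHS]integralE; congr (_ - _)%E.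
- rewrite -[RHS](ge0_integral_shift a (measurable_funepos mf) (funepos_ge0 f)).
  by apply: eq_integral => t _; rewrite funepos_comp.
- rewrite -[RHS](ge0_integral_shift a (measurable_funeneg mf) (funeneg_ge0 f)).
  by apply: eq_integral => t _; rewrite funeneg_comp.
Qed.

Lemma integral_opp (f : R -> \bar R) :
  measurable_fun [set: R] f ->
  (\int[leb]_x f (- x)%R = \int[leb]_x f x)%E.
Proof.
move=> mf; rewrite integralE [RHS]integralE; congr (_ - _)%E.
- rewrite -[RHS](ge0_integral_opp (measurable_funepos mf) (funepos_ge0 f)).
  by apply: eq_integral => t _; rewrite funepos_comp.
- rewrite -[RHS](ge0_integral_opp (measurable_funeneg mf) (funeneg_ge0 f)).
  by apply: eq_integral => t _; rewrite funeneg_comp.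
Qed.

Lemma integrable_shift (a : R) (f : R -> R) : measurable_fun [set: R] f ->
  leb.-integrable setT (EFin \o f) ->
  leb.-integrable setT (EFin \o (fun x => f (x + a))).
Proof.
move=> mf /integrableP[_ fi]; apply/integrableP; split.
  by apply/measurable_EFinP; apply: (measurableT_comp mf); exact: measurable_funD.
rewrite (ge0_integral_shift a (f := fun x => `|(f x)%:E|%E))//.
by apply: measurableT_comp => //; exact/measurable_EFinP.
Qed.

Lemma integrable_line_le (f g : R -> R) : measurable_fun [set: R] f ->
  (forall x, `|f x| <= g x) ->
  leb.-integrable setT (EFin \o g) -> leb.-integrable setT (EFin \o f).
Proof. exact: (@integrable_le_norm _ (measurableTypeR R) R leb). Qed.

Lemma integrable_lineZ (c : R) (g : R -> R) :
  leb.-integrable setT (EFin \o g) ->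
  leb.-integrable setT (EFin \o (fun x => c * g x)).
Proof. exact: (@integrableZl _ (measurableTypeR R) R leb). Qed.

Lemma derive1_expR : derive1 (@expR R) = expR.
Proof. by apply/funext => x; rewrite derive1E; exact: derive_val. Qed.

(** The substitution t = exp u, obtained on the compact intervals [-k, k] and
    extended by monotone convergence. *)
Lemma ge0_integral_expR_subst (G : R -> R) :
  (forall t, 0 < t -> {for t, continuous G}) -> (forall t, 0 < t -> 0 <= G t) ->
  (\int[leb]_(t in `]0%R, +oo[) (G t)%:E =
   \int[leb]_u (G (expR u) * expR u)%:E)%E.
Proof.
move=> cG G0.
pose A (k : nat) : set R := `[expR (- k%:R), expR k%:R]%classic.
pose B (k : nat) : set R := `[- k%:R, k%:R]%classic.
have A_gt0 k x : A k x -> 0 < x.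
  by rewrite /A /= in_itv/= => /andP[+ _]; apply: lt_le_trans; exact: expR_gt0.
have cGA k : {within A k, continuous G}.
  by apply: continuous_in_subspaceT => x /set_mem /A_gt0 /cG.
have ndA : nondecreasing_seq A.
  move=> i j ij; apply/subsetPset => x; rewrite /A /= !in_itv/= => /andP[h1 h2].
  by rewrite (le_trans _ h1) ?(le_trans h2)// ler_expR ?lerN2 ler_nat.
have ndB : nondecreasing_seq B.
  move=> i j ij; apply/subsetPset => x; rewrite /B /= !in_itv/= => /andP[h1 h2].
  by rewrite (le_trans _ h1) ?(le_trans h2)// ?lerN2 ler_nat.
have UA : \bigcup_k A k = `]0, +oo[%classic.
  apply/seteqP; split => [x [k _ /A_gt0]|x] /=; first by rewrite in_itv/= andbT.
  rewrite in_itv/= andbT => x0; exists (Num.truncn `|ln x|).+1 => //.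
  have := truncnS_gt `|ln x|; rewrite ltr_norml => /andP[h1 h2].
  by rewrite /A /= in_itv/= -[X in _ <= X <= _]lnK ?posrE// !ler_expR !ltW.
have UB : \bigcup_k B k = setT.
  apply/seteqP; split => // x _; exists (Num.truncn `|x|).+1 => //.
  have := truncnS_gt `|x|; rewrite ltr_norml => /andP[h1 h2].
  by rewrite /B /= in_itv/= !ltW.
have mGe : measurable_fun setT (fun u : R => G (expR u) * expR u).
  apply: continuous_measurable_fun => u; apply: continuousM.
    by apply: continuous_comp; [exact: continuous_expR|apply/cG/expR_gt0].
  exact: continuous_expR.
have E k : (\int[leb]_(t in A k) (G t)%:E =
            \int[leb]_(u in B k) (G (expR u) * expR u)%:E)%E.
  rewrite /A /B (@integration_by_substitution_increasing _ expR)//.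
  - by apply: eq_integral => u _ /=; rewrite derive1_expR.
  - by rewrite (@le_trans _ _ 0) ?oppr_le0.
  - by move=> x y _ _; rewrite ltr_expR.
  - by rewrite derive1_expR => x _; exact: continuous_expR.
  - rewrite derive1_expR; apply/cvg_ex; exists (expR (- k%:R)).
    by apply: cvg_at_right_filter; exact: continuous_expR.
  - rewrite derive1_expR; apply/cvg_ex; exists (expR k%:R).
    by apply: cvg_at_left_filter; exact: continuous_expR.
  - split.
    + by move=> x _; exact: derivable_expR.
    + by apply: cvg_at_right_filter; exact: continuous_expR.
    + by apply: cvg_at_left_filter; exact: continuous_expR.
  - exact: (cGA k).
rewrite -UA -[in RHS]UB.
have cA : (\int[leb]_(t in A k) (G t)%:E)%E @[k --> \oo] -->
    (\int[leb]_(t in \bigcup_k A k) (G t)%:E)%E.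
  apply: ge0_nondecreasing_set_cvg_integral => //.
  - by move=> k; exact: measurable_itv.
  - move=> k; apply/measurable_EFinP.
    by apply: subspace_continuous_measurable_fun => //; exact: measurable_itv.
  - by move=> k x /A_gt0 x0; rewrite lee_fin G0.
have cB : (\int[leb]_(u in B k) (G (expR u) * expR u)%:E)%E @[k --> \oo]
    --> (\int[leb]_(u in \bigcup_k B k) (G (expR u) * expR u)%:E)%E.
  apply: ge0_nondecreasing_set_cvg_integral => //.
  - by move=> k; exact: measurable_itv.
  - by move=> k; apply/measurable_EFinP; exact: measurable_funTS.
  - by move=> k x _; rewrite lee_fin mulr_ge0 ?expR_ge0// G0// expR_gt0.
by move: cA; under eq_fun do rewrite E; move/cvg_unique; apply.
Qed.

(** The reference integrable function on the line, 1/(1 + y^2). *)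
Definition cauchy_weight (y : R) : R := (oneDsqr y)^-1.

Lemma cauchy_weight_gt0 y : 0 < cauchy_weight y.
Proof. by rewrite invr_gt0. Qed.

Lemma cauchy_weight_le1 y : cauchy_weight y <= 1.
Proof. exact: oneDsqrV_le1. Qed.

Lemma cauchy_weightN y : cauchy_weight (- y) = cauchy_weight y.
Proof. by rewrite /cauchy_weight /oneDsqr sqrrN. Qed.

Lemma measurable_cauchy_weight : measurable_fun setT cauchy_weight.
Proof. exact: continuous_measurable_fun (@continuous_oneDsqrV R). Qed.

Lemma integrable_cauchy_weight : leb.-integrable setT (EFin \o cauchy_weight).
Proof.
apply: (@ge0_integrable_EFin _ _ _ _ _ pi).
- exact: measurable_cauchy_weight.
- by move=> y; rewrite ltW// cauchy_weight_gt0.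
- rewrite (@ge0_symfun_integralT _ cauchy_weight).
  + rewrite (_ : [set x | _] = `[0, +oo[%classic); last first.
      by apply/seteqP; split => x/=; rewrite in_itv/= andbT.
    rewrite integral0y_oneDsqr -EFinM; congr EFin.
    by rewrite mulrCA divff// mulr1.
  + by move=> y; rewrite ltW// cauchy_weight_gt0.
  + exact: continuous_oneDsqrV.
  + by move=> y /=; rewrite cauchy_weightN.
Qed.

Lemma expR_abs_le_cauchy (c u : R) : 0 < c ->
  expR (- (c * `|u|)) <= (1 + 2 / c ^+ 2) * cauchy_weight u.
Proof.
move=> c0; rewrite expRN /cauchy_weight ler_pdivlMr// ler_pdivrMl ?expR_gt0//.
have := @expR_ge1Dxn R (c * `|u|) 1 (mulr_ge0 (ltW c0) (normr_ge0 _)).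
rewrite exprMn real_normK ?num_real// /oneDsqr => h.
apply: (@le_trans _ _ ((1 + c ^+ 2 * u ^+ 2 / 2) * (1 + 2 / c ^+ 2))).
  have -> : (1 + c ^+ 2 * u ^+ 2 / 2) * (1 + 2 / c ^+ 2) =
    1 + u ^+ 2 + c ^+ 2 * u ^+ 2 / 2 + 2 / c ^+ 2 by field; rewrite gt_eqF.
  rewrite -[leRHS]addrA lerDl; apply: addr_ge0; last exact: divr_ge0 (sqr_ge0 _).
  by apply: divr_ge0 => //; exact: mulr_ge0 (sqr_ge0 _) (sqr_ge0 _).
by rewrite ler_wpM2r// addr_ge0// divr_ge0// sqr_ge0.
Qed.

End line_integrals.

(** * Gamma integrals in logarithmic time *)
Section gamma_log_coordinates.
Context {R : realType}.
Local Notation leb := (@lebesgue_measure R).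

(** The integrand of [Gamma s] after the substitution r = exp u. *)
Definition gamma_exp (s u : R) : R := expR (s * u - expR u).

Lemma measurable_gamma_exp s : measurable_fun setT (gamma_exp s).
Proof.
apply: measurableT_comp => //; apply: measurable_funB => //.
Qed.

Lemma gamma_exp_le (s : R) : 0 < s ->
  exists C, forall u, gamma_exp s u <= C * cauchy_weight u.
Proof.
move=> s0; pose c := Num.min s 1.
have c0 : 0 < c by rewrite lt_min s0/=.
(* For u >= 0, exp u >= 1 + u^2/2 and s u - u^2/2 <= (s+1)^2/2 - u;
   for u < 0 the factor exp (s u) suffices. *)
exists (expR ((s + 1) ^+ 2 / 2) * (1 + 2 / c ^+ 2)) => u.
rewrite -mulrA; apply: (@le_trans _ _ (expR ((s + 1) ^+ 2 / 2) * expR (- (c * `|u|)))).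
  rewrite -expRD ler_expR.
  have [u0|u0] := leP 0 u.
    rewrite ger0_norm//.
    have cu : c * u <= u by rewrite -[leRHS]mul1r ler_wpM2r// ge_min lexx orbT.
    have := @expR_ge1Dxn R u 1 u0; rewrite (_ : 2`!%:R = 2 :> R)// => e.
    have sq : 0 <= (s + 1 - u) ^+ 2 by exact: sqr_ge0.
    lra.
  rewrite ltr0_norm//.
  have cu : c * - u <= s * - u.
    by rewrite ler_wpM2r ?oppr_ge0 ?(ltW u0)// ge_min lexx.
  have e0 := expR_gt0 u.
  have sq : 0 <= (s + 1) ^+ 2 by exact: sqr_ge0.
  lra.
by rewrite ler_wpM2l ?expR_ge0//; exact: expR_abs_le_cauchy.
Qed.

Lemma integrable_gamma_exp s : 0 < s ->
  leb.-integrable setT (EFin \o gamma_exp s).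
Proof.
move=> s0; have [C hC] := gamma_exp_le s0.
apply: (@integrable_line_le _ _ (fun u => C * cauchy_weight u)).
- exact: measurable_gamma_exp.
- by move=> u; rewrite ger0_norm ?expR_ge0.
- by apply: integrable_lineZ; exact: integrable_cauchy_weight.
Qed.

Let gamma_integrand (s r : R) : R := expR (- r) * r `^ (s - 1).

Let gamma_subst (s : R) :
  (\int[leb]_(r in `]0%R, +oo[) (gamma_integrand s r)%:E =
   \int[leb]_u (gamma_exp s u)%:E)%E.
Proof.
rewrite ge0_integral_expR_subst.
- apply: eq_integral => u _; rewrite /gamma_integrand /gamma_exp -expRM -!expRD.
  by congr (expR _)%:E; ring.
- move=> t t0; apply: continuousM.
    by apply: continuous_comp; [exact: continuousN|exact: continuous_expR].
  apply: differentiable_continuous; apply/derivable1_diffP.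
  by apply: derivable_powR; rewrite in_itv/= andbT.
- by move=> t t0; rewrite mulr_ge0 ?expR_ge0 ?powR_ge0.
Qed.

Lemma integral_gamma_exp s : 0 < s ->
  (\int[leb]_u (gamma_exp s u)%:E)%E = (Gamma s)%:E.
Proof.
move=> s0; rewrite -gamma_subst /Gamma /Rintegral fineK// gamma_subst.
apply: (integrable_fin_num measurableT); exact: integrable_gamma_exp.
Qed.

Lemma Gamma_gt0 (s : R) : 0 < s -> 0 < Gamma s.
Proof.
move=> s0; rewrite -lte_fin -integral_gamma_exp//.
(* On [-1, 0] the integrand is at least exp (- s - 1). *)
have m01 : measurable (`[(-1)%R, 0%R] : set R) by exact: measurable_itv.
apply: (@lt_le_trans _ _ (\int[leb]_u ((expR (- s - 1))%:E *
    (\1_(`[(-1)%R, 0%R] : set R) u)%:E))%E).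
  rewrite ge0_integralZl_EFin ?expR_ge0//=.
  - rewrite integral_indic//= setIT lebesgue_measure_itv/= lte_fin ltrN10.
    by rewrite -EFinB -EFinM lte_fin mulr_gt0 ?expR_gt0// subr_gt0 ltrN10.
  - exact/measurable_EFinP/measurable_indic.
apply: ge0_le_integral => //.
- apply: emeasurable_funM => //; exact/measurable_EFinP/measurable_indic.
- by apply/measurable_EFinP; exact: measurable_gamma_exp.
move=> u _; rewrite -EFinM lee_fin indicE.
have [|_] := boolP (u \in _); last by rewrite mulr0 expR_ge0.
rewrite inE/= in_itv/= mulr1 ler_expR => /andP[u1 u0].
have e1 : expR u <= 1 by rewrite expR_le1.
have su : 0 <= s * (u + 1) by rewrite mulr_ge0 ?(ltW s0)// -lerBlDr sub0r.
rewrite lerD ?lerN2//; move: su; rewrite mulrDr mulr1; lra.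
Qed.

(** Writing q = exp k, the scaling by [q] is a translation by [k]. *)
Lemma integral_gamma_exp_scale (s q : R) : 0 < s -> 0 < q ->
  (\int[leb]_u (expR (s * u - q * expR u))%:E)%E = (Gamma s * q `^ (- s))%:E.
Proof.
move=> s0 q0.
rewrite EFinM -integral_gamma_exp//.
rewrite -(@integral_shift _ (ln q) (fun u => (gamma_exp s u)%:E)); last first.
  by apply/measurable_EFinP; exact: measurable_gamma_exp.
rewrite -integralZr//; last first.
  apply: (@integrable_shift _ (ln q) (gamma_exp s)).
    exact: measurable_gamma_exp.
  exact: integrable_gamma_exp.
apply: eq_integral => u _; rewrite -EFinM; congr EFin.
rewrite /gamma_exp /powR gt_eqF// -expRD; congr expR.
rewrite expRD lnK//; ring.
Qed.

Lemma integral_gamma_exp_invscale (s q : R) : 0 < s -> 0 < q ->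
  (\int[leb]_u (expR (- s * u - q * expR (- u)))%:E)%E = (Gamma s * q `^ (- s))%:E.
Proof.
move=> s0 q0; rewrite -(integral_gamma_exp_scale s0 q0).
rewrite -(@integral_opp _ (fun u => (expR (s * u - q * expR u))%:E)); last first.
  apply/measurable_EFinP; apply: measurableT_comp => //.
  by apply: measurable_funB; exact: measurable_funM.
by apply: eq_integral => u _; rewrite mulrN mulNr.
Qed.

(** The integrand of Gamma at 0, made convergent at -oo by subtracting the
    indicator of u < 0. *)
Definition log_exp (u : R) : R := expR (- expR u) - (u < 0)%R%:R.

Lemma measurable_lt0 : measurable_fun setT (fun u : R => (u < 0)%R%:R : R).
Proof.
rewrite (_ : (fun _ => _) = \1_(`]-oo, 0[%classic : set R)); last first.
  by apply/funext => u; rewrite indicE mem_setE in_itv.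
by apply: measurable_indic; exact: measurable_itv.
Qed.

Lemma measurable_gt0 : measurable_fun setT (fun u : R => (0 < u)%R%:R : R).
Proof.
rewrite (_ : (fun _ => _) = (fun u : R => (u < 0)%R%:R : R) \o -%R).
  by apply: measurableT_comp => //; exact: measurable_lt0.
by apply/funext => u /=; rewrite oppr_lt0.
Qed.

Lemma measurable_log_exp : measurable_fun setT log_exp.
Proof.
apply: measurable_funB; last exact: measurable_lt0.
by do 2 apply: measurableT_comp => //.
Qed.

Lemma log_exp_le u : `|log_exp u| <= 3 * cauchy_weight u.
Proof.
apply: (@le_trans _ _ (expR (- (1 * `|u|)))); last first.
  have := @expR_abs_le_cauchy R 1 u ltr01.
  by rewrite expr1n divr1 (_ : 1 + 2 = 3)//; ring.
rewrite /log_exp mul1r; have [u0|u0] := ltP u 0.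
  rewrite distrC (ltr0_norm u0) opprK ger0_norm/=.
    by rewrite lerBlDl -lerBlDr; have := expR_ge1Dx (- expR u).
  by rewrite subr_ge0 expR_le1 oppr_le0 expR_ge0.
rewrite subr0 ger0_norm ?expR_ge0// ger0_norm// ler_expR lerN2.
by apply: le_trans (expR_ge1Dx u); rewrite lerDr.
Qed.

Lemma integrable_log_exp : leb.-integrable setT (EFin \o log_exp).
Proof.
apply: (@integrable_line_le _ _ (fun u => 3 * cauchy_weight u)).
- exact: measurable_log_exp.
- exact: log_exp_le.
- by apply: integrable_lineZ; exact: integrable_cauchy_weight.
Qed.

(** The change of the subtracted indicator under translation by [k]. *)
Definition log_step (k u : R) : R := (u + k < 0)%R%:R - (u < 0)%R%:R.

Lemma log_stepE k u : log_step k u =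
  if 0 <= k then - \1_(`[- k, 0[%classic : set R) u
  else \1_(`[0, - k[%classic : set R) u.
Proof.
rewrite /log_step; case: ifPn => k0; rewrite indicE mem_setE in_itv/=.
- case: (ltP (u + k) 0) => h1; case: (ltP u 0) => h2;
    case: (leP (- k) u) => h3 /=;
    by [rewrite ?subrr ?subr0 ?sub0r ?oppr0 | exfalso; lra].
- rewrite -ltNge in k0; case: (ltP (u + k) 0) => h1; case: (ltP u 0) => h2;
    case: (ltP u (- k)) => h3 /=;
    by [rewrite ?subrr ?subr0 ?sub0r ?oppr0 | exfalso; lra].
Qed.

Lemma integral_log_step k : (\int[leb]_u (log_step k u)%:E)%E = (- k)%:E.
Proof.
have mI (a b : R) : measurable (`[a, b[ : set R) by exact: measurable_itv.
under eq_integral do rewrite log_stepE.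
have [k0|k0] := leP 0 k.
- under eq_integral do rewrite EFinN.
  rewrite integral_ge0N//.
  rewrite integral_indic//= setIT lebesgue_measure_itv/= lte_fin.
  by case: ifPn => [_|h]; rewrite ?sub0e ?EFinN//; congr (- _%:E)%E; lra.
- rewrite integral_indic//= setIT lebesgue_measure_itv/= lte_fin.
  by rewrite oppr_gt0 k0 sube0.
Qed.

Lemma integral_norm_log_step k :
  (\int[leb]_u `|(log_step k u)%:E|)%E = `|k|%:E.
Proof.
have mI (a b : R) : measurable (`[a, b[ : set R) by exact: measurable_itv.
under eq_integral do rewrite log_stepE.
have [k0|k0] := leP 0 k.
- under eq_integral do rewrite EFinN abseN gee0_abs ?lee_fin//.
  rewrite integral_indic//= setIT lebesgue_measure_itv/= lte_fin.
  rewrite ger0_norm//; case: ifPn => [_|h]; rewrite ?sub0e -?EFinN ?opprK//;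
    by congr EFin; lra.
- under eq_integral do rewrite gee0_abs ?lee_fin//.
  rewrite integral_indic//= setIT lebesgue_measure_itv/= lte_fin.
  by rewrite oppr_gt0 k0 sube0 ltr0_norm.
Qed.

Lemma measurable_log_step k : measurable_fun setT (log_step k).
Proof.
apply: measurable_funB; last exact: measurable_lt0.
exact: (measurableT_comp measurable_lt0 (measurable_funD _ _)).
Qed.

Lemma integrable_log_step k : leb.-integrable setT (EFin \o log_step k).
Proof.
apply/integrableP; split; first by apply/measurable_EFinP; exact: measurable_log_step.
by rewrite integral_norm_log_step ltry.
Qed.

(** The heat kernel at logarithmic time [u] and squared distance 4 q, without
    its power of time, minus the indicator of large times. *)
Definition log_heat (q u : R) : R :=
  expR (- (q * expR (- u))) - (0 < u)%R%:R.

Lemma log_heatE q u : 0 < q ->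
  log_heat q (- u) = log_exp (u + ln q) + log_step (ln q) u.
Proof.
move=> q0; rewrite /log_heat /log_exp /log_step opprK expRD lnK// oppr_gt0.
by rewrite [expR u * q]mulrC; ring.
Qed.

Lemma measurable_log_heat q : measurable_fun setT (log_heat q).
Proof.
apply: measurable_funB.
  apply: measurableT_comp => //; apply: measurableT_comp => //.
  apply: measurable_funM => //; exact: measurableT_comp.
exact: measurable_gt0.
Qed.

Let integrable_log_exp_shift k :
  leb.-integrable setT (EFin \o (fun u => log_exp (u + k))).
Proof. exact: integrable_shift measurable_log_exp integrable_log_exp. Qed.

Lemma integral_norm_log_heat q : 0 < q ->
  (\int[leb]_u `|(log_heat q u)%:E| <=
   (\int[leb]_u `|log_exp u| + `|ln q|)%:E)%E.
Proof.
move=> q0; rewrite -(@integral_opp _ (fun u => `|(log_heat q u)%:E|%E)); last first.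
  by apply: measurableT_comp => //; apply/measurable_EFinP; exact: measurable_log_heat.
have ml : measurable_fun setT (fun u : R => (log_exp (u + ln q))%:E).
  by apply/measurable_EFinP; have /measurable_int/measurable_EFinP :=
    integrable_log_exp_shift (ln q).
have ms : measurable_fun setT (fun u : R => (log_step (ln q) u)%:E).
  apply/measurable_EFinP; exact: measurable_log_step.
apply: (@le_trans _ _ (\int[leb]_u (`|(log_exp (u + ln q))%:E| +
    `|(log_step (ln q) u)%:E|))%E).
  apply: ge0_le_integral => //.
  - apply: measurableT_comp => //; apply/measurable_EFinP.
    exact: (measurableT_comp (measurable_log_heat q)).
  - by apply: emeasurable_funD; exact: measurableT_comp.
  - by move=> u _; rewrite log_heatE//= lee_fin ler_normD.
rewrite ge0_integralD//; [|exact: measurableT_comp|exact: measurableT_comp].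
rewrite integral_norm_log_step EFinD leeD2r//.
rewrite (@integral_shift _ (ln q) (fun u => `|(log_exp u)%:E|%E)).
  rewrite -(@integral_EFin_Rintegral _ (measurableTypeR R) _ leb)//.
  exact: (@integrable_norm _ (measurableTypeR R) _ leb _ _ integrable_log_exp).
by apply: measurableT_comp => //; apply/measurable_EFinP; exact: measurable_log_exp.
Qed.

Lemma integral_log_heat q : 0 < q ->
  (\int[leb]_u (log_heat q u)%:E)%E = (\int[leb]_u log_exp u - ln q)%:E.
Proof.
move=> q0; rewrite -(@integral_opp _ (fun u => (log_heat q u)%:E)); last first.
  apply/measurable_EFinP; exact: measurable_log_heat.
under eq_integral do rewrite log_heatE// EFinD.
rewrite integralD//; [|exact: integrable_log_exp_shift|exact: integrable_log_step].
rewrite integral_log_step EFinB; congr (_ + _)%E.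
rewrite (@integral_shift _ (ln q) (fun u => (log_exp u)%:E)).
  by rewrite -(@integral_EFin_Rintegral _ (measurableTypeR R) _ leb)//; exact: integrable_log_exp.
apply/measurable_EFinP; exact: measurable_log_exp.
Qed.

End gamma_log_coordinates.

(** * Local integrability of powers of the Euclidean norm *)
Section measurable_projections.
Context d1 d2 d3 (A : measurableType d1) (B : measurableType d2)
  (C : measurableType d3).

Lemma measurable_comp_fst (f : A -> C) : measurable_fun setT f ->
  measurable_fun setT (fun p : A * B => f p.1).
Proof. by move=> mf; exact: (measurableT_comp mf measurable_fst). Qed.

Lemma measurable_comp_snd (f : B -> C) : measurable_fun setT f ->
  measurable_fun setT (fun p : A * B => f p.2).
Proof. by move=> mf; exact: (measurableT_comp mf measurable_snd). Qed.

End measurable_projections.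

Section riesz_weight.
Context {R : realType}.
Local Notation leb := (@lebesgue_measure R).
Local Notation mu n := (lebesgue_tuple R n).
Local Notation T n := (n.-tuple (measurableTypeR R)).

Lemma integral_gauss_line (t c : R) : 0 < t ->
  (\int[leb]_y (expR (- (t * (c - y) ^+ 2)))%:E)%E = (Num.sqrt (pi / t))%:E.
Proof.
move=> t0; pose r := Num.sqrt t; have r0 : 0 < r by rewrite sqrtr_gt0.
have mg (d : R) : measurable_fun setT (fun y : R => (expR (- (t * (y + d) ^+ 2)))%:E).
  apply/measurable_EFinP; apply: measurableT_comp => //.
  apply: measurableT_comp => //; apply: measurable_funM => //.
  by apply: measurable_funX; exact: measurable_funD.
transitivity (\int[leb]_y (expR (- (t * (y + 0) ^+ 2)))%:E)%E.
  rewrite -[RHS](@integral_shift _ (- c) _ (mg 0)).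
  by apply: eq_integral => y _; rewrite addr0 -sqrrN opprB.
have H := @increasing_ge0_integration_by_substitutionT R (fun y => r * y) gauss_fun.
have dF : derive1 (fun y : R => r * y) = cst r.
  apply/funext => y; rewrite derive1E.
  have -> : 'D_1 (fun y0 : R => r * y0) y = r *: 1 + y *: 0.
    exact: derive_val.
  by rewrite scaler0 addr0 scaler1.
rewrite integralT_gauss dF in H.
have {}H : (\int[leb]_y (expR (- (t * (y + 0) ^+ 2)) * r)%:E)%E = (Num.sqrt pi)%:E.
  rewrite H.
  - apply: eq_integral => y _; rewrite !fctE /= /gauss_fun addr0 exprMn.
    by rewrite sqr_sqrtr ?ltW.
  - by move=> x y xy; rewrite ltr_pM2l.
  - exact: cst_continuous.
  - exact: is_cvg_cst.
  - exact: is_cvg_cst.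
  - by move=> y; exact: ex_derive.
  - apply: gt0_cvgMrNy => //.
  - apply: gt0_cvgMry => //.
  - exact: continuous_gauss_fun.
  - exact: gauss_fun_ge0.
rewrite sqrtrM ?pi_ge0// sqrtrV ?ltW// -/r.
have -> : (Num.sqrt pi / r)%:E = (r^-1%:E * (Num.sqrt pi)%:E :> \bar R)%E.
  by rewrite -EFinM mulrC.
rewrite -H -ge0_integralZl_EFin//; last 3 first.
- by move=> y _; rewrite lee_fin mulr_ge0 ?expR_ge0// ltW.
- apply/measurable_EFinP; apply: measurable_funM => //.
  by apply/measurable_EFinP; exact: mg.
- by rewrite invr_ge0 ltW.
by apply: eq_integral => y _; rewrite -EFinM [_^-1 * _]mulrCA mulVf ?mulr1// gt_eqF.
Qed.

Lemma dotp_row n (x : 'rV[R]_n) (z : T n) :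
  dotp (x - row_of_tuple z) (x - row_of_tuple z) =
  \sum_i (x 0 i - (tnth z i : R)) ^+ 2.
Proof. by apply: eq_bigr => i _; rewrite !mxE expr2. Qed.

Lemma measurable_dotp_sub n (x : 'rV[R]_n) :
  measurable_fun setT (fun z : T n =>
    dotp (x - row_of_tuple z) (x - row_of_tuple z)).
Proof.
under eq_fun do rewrite dotp_row.
apply: measurable_sum => i; apply: measurable_funX; apply: measurable_funB => //.
exact: measurable_tnth.
Qed.

Lemma expR_dotp_row n (t : R) (x : 'rV[R]_n) (z : T n) :
  expR (- (t * dotp (x - row_of_tuple z) (x - row_of_tuple z))) =
  \prod_i expR (- (t * (x 0 i - (tnth z i : R)) ^+ 2)).
Proof. by rewrite dotp_row mulr_sumr -sumrN expR_sum. Qed.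

Lemma integral_gauss_tuple n (t : R) (x : 'rV[R]_n) : 0 < t ->
  (\int[mu n]_z (expR (- (t * dotp (x - row_of_tuple z) (x - row_of_tuple z))))%:E)%E
  = (Num.sqrt (pi / t) ^+ n)%:E.
Proof.
move=> t0; under eq_integral do rewrite expR_dotp_row.
rewrite (@ge0_integral_tuple_prod _ _ (fun i y => expR (- (t * (x 0 i - y) ^+ 2)))
  (fun=> Num.sqrt (pi / t))).
- by rewrite prodr_const card_ord.
- move=> i; apply: measurableT_comp => //; apply: measurableT_comp => //.
  by apply: measurable_funM => //; apply: measurable_funX; exact: measurable_funB.
- by move=> i y; exact: expR_ge0.
- by move=> i; exact: integral_gauss_line.
Qed.

(** The reference integrable function on row vectors: a product of
    one-dimensional weights, so that its integral factors. *)
Definition weight n (x : 'rV[R]_n) : R := \prod_i cauchy_weight (x 0 i).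

Lemma weight_gt0 n (x : 'rV[R]_n) : 0 < weight x.
Proof. by apply: prodr_gt0 => i _; exact: cauchy_weight_gt0. Qed.

Lemma weight_ge0 n (x : 'rV[R]_n) : 0 <= weight x.
Proof. exact: ltW (weight_gt0 x). Qed.

Lemma weight_le n (x : 'rV[R]_n) i : weight x <= cauchy_weight (x 0 i).
Proof.
rewrite /weight (bigD1 i)//= ler_piMr ?(ltW (cauchy_weight_gt0 _))//.
apply: prodr_ile1 => j _.
by rewrite (ltW (cauchy_weight_gt0 _)) cauchy_weight_le1.
Qed.

Lemma weight_le1 n (x : 'rV[R]_n) : weight x <= 1.
Proof.
apply: prodr_ile1 => j _.
by rewrite (ltW (cauchy_weight_gt0 _)) cauchy_weight_le1.
Qed.

Lemma weight_row n (z : T n) :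
  weight (row_of_tuple z) = \prod_i cauchy_weight (tnth z i).
Proof. by apply: eq_bigr => i _; rewrite mxE. Qed.

Lemma integrable_weight n :
  (mu n).-integrable setT (EFin \o (fun z => weight (row_of_tuple z))).
Proof.
rewrite (_ : (fun z => _) = fun z : T n => \prod_i cauchy_weight (tnth z i)); last first.
  by apply/funext => z; rewrite weight_row.
apply: (@integrable_tuple_prod R n (fun=> cauchy_weight)) => i.
- exact: measurable_cauchy_weight.
- by move=> y; rewrite ltW// cauchy_weight_gt0.
- exact: integrable_cauchy_weight.
Qed.

Lemma measurable_weight n : measurable_fun setT (fun z : T n => weight (row_of_tuple z)).
Proof. by have /measurable_int/measurable_EFinP := integrable_weight n. Qed.

Lemma enorm_powR n (x : 'rV[R]_n) a : enorm x `^ a = dotp x x `^ (a / 2).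
Proof.
have d0 : 0 <= dotp x x by apply: sumr_ge0 => i _; rewrite -expr2 sqr_ge0.
by rewrite /enorm -powR12_sqrt// -powRrM mulrC.
Qed.

Lemma dotp_ge0 n (x : 'rV[R]_n) : 0 <= dotp x x.
Proof. by apply: sumr_ge0 => i _; rewrite -expr2 sqr_ge0. Qed.

Lemma dotp_gt0 n (x : 'rV[R]_n) : x != 0 -> 0 < dotp x x.
Proof.
move=> x0; rewrite lt_neqAle dotp_ge0 andbT; apply: contra x0.
rewrite eq_sym psumr_eq0; last by move=> i _; rewrite -expr2 sqr_ge0.
move/allP => H; apply/eqP/rowP => i; rewrite mxE.
by have := H i (mem_index_enum _); rewrite /= mulf_eq0 orbb => /eqP.
Qed.

Lemma integral_gamma_enorm n (x : 'rV[R]_n) a : 0 < a -> x != 0 ->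
  (\int[leb]_u (expR (a / 2 * u - dotp x x * expR u))%:E)%E =
  (Gamma (a / 2) * enorm x `^ (- a))%:E.
Proof.
move=> a0 x0; rewrite integral_gamma_exp_scale ?divr_gt0 ?dotp_gt0//.
by rewrite enorm_powR mulNr.
Qed.

Lemma measurable_dotp_sub_powR n (x : 'rV[R]_n) a :
  measurable_fun setT (fun z : T n => enorm (x - row_of_tuple z) `^ a).
Proof.
under eq_fun do rewrite enorm_powR.
by apply: (measurableT_comp (measurable_powR _)); exact: measurable_dotp_sub.
Qed.

(** The integrand of |x - z|^(-a) w(z), where the power is expanded as a Gamma
    integral over [p.2]. *)
Let J n (x : 'rV[R]_n) a (p : T n * measurableTypeR R) : R :=
  expR (a / 2 * p.2 - dotp (x - row_of_tuple p.1) (x - row_of_tuple p.1) * expR p.2)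
  * weight (row_of_tuple p.1).

Let measurable_J n (x : 'rV[R]_n) a : measurable_fun setT (J x a).
Proof.
apply: measurable_funM; last first.
  exact: (@measurable_comp_fst _ _ _ (T n) (measurableTypeR R) _
    (fun z => weight (row_of_tuple z)) (@measurable_weight n)).
apply: measurableT_comp => //; apply: measurable_funB.
  exact: measurable_funM.
apply: measurable_funM.
  exact: (@measurable_comp_fst _ _ _ (T n) (measurableTypeR R) _
    _ (measurable_dotp_sub x)).
exact: (@measurable_comp_snd _ _ _ (T n) (measurableTypeR R) _
  _ (@measurable_expR R)).
Qed.

Let J_ge0 n (x : 'rV[R]_n) a p : 0 <= J x a p.
Proof. by rewrite mulr_ge0 ?expR_ge0 ?weight_ge0. Qed.

(** The bound by the Gaussian integral is the smaller one for large [u], the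
    bound by the mass of the weight for small [u]. *)
Let int_J_z n (x : 'rV[R]_n) a u :
  (\int[mu n]_z (J x a (z, u))%:E <=
  (expR (a / 2 * u) * Num.min (Num.sqrt (pi / expR u) ^+ n)
     (\int[mu n]_z weight (row_of_tuple z)))%:E)%E.
Proof.
have E z : (J x a (z, u))%:E = ((expR (a / 2 * u))%:E * (expR (- (expR u *
    dotp (x - row_of_tuple z) (x - row_of_tuple z))) * weight (row_of_tuple z))%:E)%E.
  rewrite -EFinM /J/= expRD mulrA; congr (_ * expR _ * _)%:E.
  by rewrite mulrC.
under eq_integral do rewrite E.
have me : measurable_fun setT (fun z : T n => expR (- (expR u *
    dotp (x - row_of_tuple z) (x - row_of_tuple z)))).
  apply: measurableT_comp => //; apply: measurableT_comp => //.
  by apply: measurable_funM => //; exact: measurable_dotp_sub.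
rewrite ge0_integralZl_EFin ?expR_ge0//; last 2 first.
- by move=> z _; rewrite lee_fin mulr_ge0 ?expR_ge0 ?weight_ge0.
- by apply/measurable_EFinP; apply: measurable_funM => //; exact: measurable_weight.
rewrite EFinM lee_wpmul2l ?lee_fin ?expR_ge0// EFin_min le_min; apply/andP; split.
- rewrite -(@integral_gauss_tuple n (expR u) x) ?expR_gt0//.
  apply: ge0_le_integral => //.
  + by move=> z _; rewrite lee_fin mulr_ge0 ?expR_ge0 ?weight_ge0.
  + by apply/measurable_EFinP; apply: measurable_funM => //; exact: measurable_weight.
  + exact/measurable_EFinP.
  + by move=> z _; rewrite lee_fin ler_piMr ?expR_ge0 ?weight_le1.
- rewrite -integral_EFin_Rintegral; last exact: integrable_weight.
  apply: ge0_le_integral => //.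
  + by move=> z _; rewrite lee_fin mulr_ge0 ?expR_ge0 ?weight_ge0.
  + by apply/measurable_EFinP; apply: measurable_funM => //; exact: measurable_weight.
  + by apply/measurable_EFinP; exact: measurable_weight.
  + move=> z _; rewrite lee_fin ler_piMl ?weight_ge0// expR_le1 oppr_le0.
    by rewrite mulr_ge0 ?expR_ge0 ?dotp_ge0.
Qed.

(** By Tonelli the integral is at most one over [u] of
    exp (a u / 2) min (C exp (- n u / 2), C'), which decays at both ends exactly
    when 0 < a < n. *)
Lemma integrable_enorm_weight n (x : 'rV[R]_n) a : 0 < a -> a < n%:R ->
  (mu n).-integrable setT (EFin \o (fun z =>
    enorm (x - row_of_tuple z) `^ (- a) * weight (row_of_tuple z))).
Proof.
move=> a0 an; pose w := \int[mu n]_z weight (row_of_tuple z).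
pose C := Num.sqrt pi ^+ n + w; pose c := Num.min a (n%:R - a) / 2.
have w0 : 0 <= w by apply: Rintegral_ge0 => z _; exact: weight_ge0.
have c0 : 0 < c by rewrite divr_gt0// lt_min a0 subr_gt0.
have bound u : expR (a / 2 * u) * Num.min (Num.sqrt (pi / expR u) ^+ n) w <=
    C * ((1 + 2 / c ^+ 2) * cauchy_weight u).
  apply: (@le_trans _ _ (C * expR (- (c * `|u|)))); last first.
    rewrite ler_wpM2l ?expR_abs_le_cauchy//.
    by rewrite addr_ge0 ?exprn_ge0 ?sqrtr_ge0.
  have [u0|u0] := leP 0 u.
    apply: (@le_trans _ _ (expR (a / 2 * u) * Num.sqrt (pi / expR u) ^+ n)).
      by rewrite ler_wpM2l ?expR_ge0// ge_min lexx.
    rewrite sqrtrM ?pi_ge0// -expRN -(powR12_sqrt (expR_ge0 (- u))) -expRM exprMn.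
    rewrite -expRM_natl mulrCA -expRD.
    apply: ler_pM; rewrite ?exprn_ge0 ?sqrtr_ge0 ?expR_ge0//.
      by rewrite lerDl.
    rewrite ler_expR ger0_norm//.
    have h : c <= (n%:R - a) / 2 by rewrite ler_pM2r ?invr_gt0// ge_min lexx orbT.
    have := ler_wpM2r u0 h; lra.
  apply: (@le_trans _ _ (expR (a / 2 * u) * w)).
    by rewrite ler_wpM2l ?expR_ge0// ge_min lexx orbT.
  rewrite mulrC; apply: ler_pM; rewrite ?expR_ge0//.
    by rewrite lerDr exprn_ge0 ?sqrtr_ge0.
  rewrite ler_expR ltr0_norm// mulrN opprK ler_wnM2r ?(ltW u0)//.
  by rewrite ler_pM2r ?invr_gt0// ge_min lexx.
have mf : measurable_fun setT (fun z : T n =>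
    enorm (x - row_of_tuple z) `^ (- a) * weight (row_of_tuple z)).
  by apply: measurable_funM; [exact: measurable_dotp_sub_powR|exact: measurable_weight].
have G0 : 0 < Gamma (a / 2) by rewrite Gamma_gt0 ?divr_gt0.
suff H : (\int[mu n]_z (Gamma (a / 2) * (enorm (x - row_of_tuple z) `^ (- a) *
    weight (row_of_tuple z)))%:E < +oo)%E.
  have : (mu n).-integrable setT (EFin \o (fun z => Gamma (a / 2) *
      (enorm (x - row_of_tuple z) `^ (- a) * weight (row_of_tuple z)))).
    apply/integrableP; split; first by apply/measurable_EFinP; exact: measurable_funM.
    under eq_integral => z _ do
      rewrite /= ger0_norm ?mulr_ge0 ?powR_ge0 ?weight_ge0 ?(ltW G0)//.
    exact: H.
  move=> /(integrableZl measurableT (Gamma (a / 2))^-1); apply: eq_integrable => //.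
  by move=> z _ /=; rewrite -EFinM mulKf ?gt_eqF.
have mJ : measurable_fun setT (fun p => (J x a p)%:E).
  by apply/measurable_EFinP; exact: measurable_J.
have J0 p : (0 <= (J x a p)%:E)%E by rewrite lee_fin.
apply: (@le_lt_trans _ _ (\int[mu n]_z \int[leb]_u (J x a (z, u))%:E)%E).
  apply: ge0_le_integral => //.
  - by move=> z _; rewrite lee_fin !mulr_ge0 ?powR_ge0 ?weight_ge0 ?(ltW G0).
  - by apply/measurable_EFinP; exact: measurable_funM.
  - exact: (measurable_fun_fubini_tonelli_F (fun p => (J x a p)%:E) mJ J0).
  move=> z _; have [xz|xz] := eqVneq (x - row_of_tuple z) 0.
    rewrite enorm_powR xz /dotp big1 ?powR0; last 2 first.
    - by rewrite mulf_neq0 ?oppr_eq0 ?gt_eqF.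
    - by move=> i _; rewrite mxE mul0r.
    by rewrite mul0r mulr0; exact: integral_ge0.
  rewrite mulrA EFinM -integral_gamma_enorm// muleC.
  rewrite -ge0_integralZl_EFin ?weight_ge0//.
  - rewrite le_eqVlt; apply/orP; left; apply/eqP; apply: eq_integral => u _.
    by rewrite /J/= -EFinM mulrC.
  - apply/measurable_EFinP; apply: measurableT_comp => //.
    by apply: measurable_funB; exact: measurable_funM.
rewrite (fubini_tonelli (fun p => (J x a p)%:E))//.
apply: (@le_lt_trans _ _ (\int[leb]_u (C * ((1 + 2 / c ^+ 2) * cauchy_weight u))%:E)%E).
  apply: ge0_le_integral => //.
  - by move=> u _; apply: integral_ge0.
  - exact: (measurable_fun_fubini_tonelli_G (fun p => (J x a p)%:E) mJ J0).
  - apply/measurable_EFinP; do 2 apply: measurable_funM => //.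
    exact: measurable_cauchy_weight.
  - by move=> u _; apply: (le_trans (int_J_z _ _ _)); rewrite lee_fin.
rewrite (@integral_EFin_Rintegral _ (measurableTypeR R) _ leb) ?ltry//.
by do 2 apply: integrable_lineZ; exact: integrable_cauchy_weight.
Qed.

End riesz_weight.

(** * Rapid decay and integrals of derivatives *)
Section differentiation_under_integral_sign.
Context d (T : measurableType d) (R : realType).
Variable mu : {measure set T -> \bar R}.

Lemma is_derive_Rintegral (f f' : R -> T -> R) (G : T -> R) (a u v : R) :
  u < a < v ->
  (forall r, u < r < v -> mu.-integrable setT (EFin \o f r)) ->
  (forall r y, u < r < v -> is_derive r 1 (f ^~ y) (f' r y)) ->
  mu.-integrable setT (EFin \o G) ->
  (forall r y, u < r < v -> `|f' r y| <= G y) ->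
  is_derive a 1 (fun r => \int[mu]_y f r y) (\int[mu]_y f' a y).
Proof.
move=> uav fi fd Gi Gb.
have I r : (`]u, v[%classic : set R) r -> u < r < v by rewrite /= in_itv.
have Ia : (`]u, v[%classic : set R) a by rewrite /= in_itv.
have dE r y : u < r < v -> partial1of2 f r y = f' r y.
  by move=> /(fd r y) fry; rewrite partial1of2E; exact: derive_val.
have H1 r : (`]u, v[%classic : set R) r -> mu.-integrable setT (EFin \o f r).
  by move=> /I /fi.
have H2 r y : (`]u, v[%classic : set R) r -> setT y -> derivable (f ^~ y) r 1.
  by move=> /I /(fd r y) fry _; exact: ex_derive.
have G0 y : 0 <= G y by apply: le_trans (Gb a y uav).
have H3 r y : (`]u, v[%classic : set R) r -> setT y -> `|partial1of2 f r y| <= G y.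
  by move=> /I ruv _; rewrite dE// Gb.
apply: DeriveDef.
  exact: (derivable_under_integral measurableT Ia H1 H2 G0 Gi H3).
rewrite -derive1E.
rewrite (differentiation_under_integral measurableT Ia H1 H2 G0 Gi H3).
by apply: eq_Rintegral => y _; rewrite dE.
Qed.

End differentiation_under_integral_sign.

Section weight_bounds.
Context {R : realType}.
Local Notation mu n := (lebesgue_tuple R n).
Local Notation T n := (n.-tuple (measurableTypeR R)).

Lemma cauchy_weight_shift (x h : R) (e : R) : `|h| <= `|e| ->
  cauchy_weight (x + h) <= (2 + 2 * e ^+ 2) * cauchy_weight x.
Proof.
move=> he; have he2 : h ^+ 2 <= e ^+ 2.
  by rewrite -(real_normK (num_real h)) -(real_normK (num_real e)) lerXn2r ?nnegrE.
rewrite /cauchy_weight ler_pdivlMr// mulrC ler_pdivrMr// /oneDsqr.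
have h1 : 0 <= (x + 2 * h) ^+ 2 by exact: sqr_ge0.
have h2 : 0 <= e ^+ 2 * (x + h) ^+ 2 by rewrite mulr_ge0 ?sqr_ge0.
lra.
Qed.

Lemma row_shift_tuple n (a : 'I_n -> R) (z : T n) :
  row_of_tuple (shift_tuple a z) = row_of_tuple z + \row_i a i.
Proof. by apply/rowP => i; rewrite !mxE tnth_mktuple. Qed.

Lemma weight_shift n (e : 'rV[R]_n) : exists2 C, 0 <= C &
  forall (h : R) (x : 'rV[R]_n), `|h| <= 1 ->
    weight (x + h *: e) <= C * weight x.
Proof.
exists (\prod_i (2 + 2 * (e 0 i) ^+ 2)).
  by apply: prodr_ge0 => i _; rewrite addr_ge0// mulr_ge0// sqr_ge0.
move=> h x h1; rewrite /weight -big_split/=; apply: ler_prod => i _.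
rewrite (ltW (cauchy_weight_gt0 _))/= !mxE; apply: cauchy_weight_shift.
by rewrite normrM ler_piMl.
Qed.

(** Decay like the square of the weight.  The second power of the weight
    leaves room to absorb a coordinate or the norm, and still be integrable. *)
Definition rapid n (g : 'rV[R]_n -> R) : Prop :=
  exists2 C, 0 <= C & forall x, `|g x| <= C * weight x ^+ 2.

Lemma abs_coord_weight n (x : 'rV[R]_n) i : `|x 0 i| * weight x <= 1.
Proof.
apply: (@le_trans _ _ (`|x 0 i| * cauchy_weight (x 0 i))).
  by rewrite ler_wpM2l// weight_le.
rewrite /cauchy_weight ler_pdivrMr// mul1r /oneDsqr.
rewrite -(real_normK (num_real (x 0 i))).
have : 0 <= (`|x 0 i| - 1 / 2) ^+ 2 by exact: sqr_ge0.
lra.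
Qed.

Lemma dotp_weight_le n (y x : 'rV[R]_n) :
  `|dotp y x| * weight x <= \sum_i `|y 0 i|.
Proof.
apply: (@le_trans _ _ ((\sum_i `|y 0 i| * `|x 0 i|) * weight x)).
  rewrite ler_wpM2r ?weight_ge0//; apply: le_trans (ler_norm_sum _ _ _) _.
  by apply: ler_sum => i _; rewrite normrM.
rewrite mulr_suml; apply: ler_sum => i _.
by rewrite -mulrA ler_piMr// abs_coord_weight.
Qed.

Lemma rapid_le_weight n (g : 'rV[R]_n -> R) : rapid g ->
  exists2 C, 0 <= C & forall x, `|g x| <= C * weight x.
Proof.
move=> [C C0 gC]; exists C => // x; apply: le_trans (gC x) _.
by rewrite ler_wpM2l// expr2 ler_piMr ?weight_ge0 ?weight_le1.
Qed.

Lemma integrable_weight_le n (g : 'rV[R]_n -> R) C :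
  measurable_fun setT (g \o @row_of_tuple R n) ->
  (forall x, `|g x| <= C * weight x) ->
  (mu n).-integrable setT (EFin \o (fun z => g (row_of_tuple z))).
Proof.
move=> mg gC.
apply: (@integrable_le_norm _ _ _ _ _ (fun z => C * weight (row_of_tuple z))) => //.
exact: (integrableZl measurableT C (integrable_weight n)).
Qed.

Lemma rapid_integrable n (g : 'rV[R]_n -> R) :
  measurable_fun setT (g \o @row_of_tuple R n) -> rapid g ->
  (mu n).-integrable setT (EFin \o (fun z => g (row_of_tuple z))).
Proof. by move=> mg /rapid_le_weight[C _]; exact: integrable_weight_le. Qed.

(** The integral of [g] translated by [h *: e] does not depend on [h];
    differentiate it at h = 0. *)
Lemma Rintegral_directional_derive0 n (g g' : 'rV[R]_n -> R) (e : 'rV[R]_n) C :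
  measurable_fun setT (g \o @row_of_tuple R n) ->
  (forall x, `|g x| <= C * weight x) ->
  (forall x (h : R), is_derive h 1 (fun k => g (x + k *: e)) (g' (x + h *: e))) ->
  (forall x, `|g' x| <= C * weight x) ->
  \int[mu n]_z g' (row_of_tuple z) = 0.
Proof.
move=> mg gC gd g'C.
have C0 : 0 <= C.
  rewrite -(pmulr_lge0 _ (weight_gt0 (0 : 'rV[R]_n))).
  exact: le_trans (normr_ge0 _) (gC 0).
have [D D0 wD] := weight_shift e.
pose a (h : R) : 'I_n -> R := fun i => h * e 0 i.
have aE h z : row_of_tuple (shift_tuple (a h) z) = row_of_tuple z + h *: e.
  by rewrite row_shift_tuple; congr (_ + _); apply/rowP => i; rewrite !mxE.
have mgh h : measurable_fun setT (fun z : T n => g (row_of_tuple z + h *: e)).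
  rewrite (_ : (fun z => _) = (g \o @row_of_tuple R n) \o shift_tuple (a h)).
    by apply: measurableT_comp => //; exact: measurable_shift_tuple.
  by apply/funext => z /=; rewrite aE.
have K (f : 'rV[R]_n -> R) h z : (forall x, `|f x| <= C * weight x) -> `|h| <= 1 ->
    `|f (row_of_tuple z + h *: e)| <= C * D * weight (row_of_tuple z).
  move=> fC h1; apply: le_trans (fC _) _.
  by rewrite -mulrA ler_wpM2l// wD.
have hle (h : R) : -1 < h < 1 -> `|h| <= 1.
  by move=> /andP[? ?]; rewrite ler_norml !ltW.
have iG : (mu n).-integrable setT (EFin \o (fun z => C * D * weight (row_of_tuple z))).
  exact: (integrableZl measurableT (C * D) (integrable_weight n)).
have := @is_derive_Rintegral _ (T n) R (mu n)
  (fun h z => g (row_of_tuple z + h *: e)) (fun h z => g' (row_of_tuple z + h *: e))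
  (fun z => C * D * weight (row_of_tuple z)) 0 (-1) 1.
rewrite ltrN10 ltr01 => /(_ isT).
have -> : (fun h => \int[mu n]_z g (row_of_tuple z + h *: e)) =
    cst (\int[mu n]_z g (row_of_tuple z)).
  apply/funext => h; rewrite /Rintegral; congr fine.
  rewrite -(integral_tuple_shift (a h) (f := fun z => (g (row_of_tuple z))%:E)).
    by apply: eq_integral => z _; rewrite aE.
  exact/measurable_EFinP.
move=> H.
have {}H : is_derive (0 : R) 1 (cst (\int[mu n]_z g (row_of_tuple z)) : R -> R)
    (\int[mu n]_z g' (row_of_tuple z + 0 *: e)).
  apply: H => //.
  - move=> r r1; apply: integrable_le_norm iG; first exact: mgh.
    by move=> z; apply: K => //; exact: hle.
  - by move=> r y r1; apply: K => //; exact: hle.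
have := @derive_val _ _ _ _ _ _ _ H.
rewrite (@derive_val _ _ _ _ _ _ _ (is_derive_cst _ _ _)) => E.
by rewrite [RHS]E; apply: eq_Rintegral => z _; rewrite scale0r addr0.
Qed.

(** Expanding \prod_i (1 + x_i^4) over subsets reduces rapid decay to finitely
    many monomial bounds. *)
Lemma rapid_of_monomials n (g : 'rV[R]_n -> R) :
  (forall S : {set 'I_n}, exists M, forall x : 'rV[R]_n,
     (\prod_(i in S) (x 0 i) ^+ 4) * `|g x| <= M) -> rapid g.
Proof.
move=> /fin_all_exists[M gM].
exists (2 ^+ n * \sum_(S : {set 'I_n}) M S).
  rewrite mulr_ge0 ?exprn_ge0// sumr_ge0// => S _.
  apply: le_trans (gM S 0); rewrite mulr_ge0// prodr_ge0// => i _.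
  by rewrite exprn_even_ge0.
move=> x; rewrite -ler_pdivrMr ?exprn_gt0 ?weight_gt0//.
apply: (@le_trans _ _ (2 ^+ n * ((\prod_i ((x 0 i) ^+ 4 + 1)) * `|g x|))).
  rewrite mulrA mulrC ler_wpM2r//.
  rewrite -exprVn /weight -prodfV -prodrXl.
  have -> : 2 ^+ n = \prod_(i < n) 2 :> R by rewrite prodr_const card_ord.
  rewrite -big_split/=.
  apply: ler_prod => i _; rewrite exprn_ge0 ?invr_ge0 ?(ltW (cauchy_weight_gt0 _))//=.
  rewrite /cauchy_weight invrK /oneDsqr.
  have : 0 <= (x 0 i ^+ 2 - 1) ^+ 2 by exact: sqr_ge0.
  rewrite (_ : x 0 i ^+ 4 = (x 0 i ^+ 2) ^+ 2) -?exprM//; lra.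
rewrite ler_wpM2l ?exprn_ge0// bigA_distr mulr_suml; apply: ler_sum => S _.
by rewrite -big_mkcond/=.
Qed.

End weight_bounds.

(** * Fourier transform of the Gaussian *)
Section gaussian_fourier.
Context {R : realType}.
Local Notation mu n := (lebesgue_tuple R n).
Local Notation T n := (n.-tuple (measurableTypeR R)).

Lemma dotpC n (x y : 'rV[R]_n) : dotp x y = dotp y x.
Proof. by apply: eq_bigr => i _; rewrite mulrC. Qed.

Lemma dotpDl n (x y z : 'rV[R]_n) : dotp (x + y) z = dotp x z + dotp y z.
Proof.
by rewrite /dotp -big_split/=; apply: eq_bigr => i _; rewrite mxE mulrDl.
Qed.

Lemma dotpDr n (x y z : 'rV[R]_n) : dotp x (y + z) = dotp x y + dotp x z.
Proof. by rewrite dotpC dotpDl !(dotpC _ x). Qed.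

Lemma dotpZl n k (x y : 'rV[R]_n) : dotp (k *: x) y = k * dotp x y.
Proof.
by rewrite /dotp mulr_sumr; apply: eq_bigr => i _; rewrite mxE mulrA.
Qed.

Lemma dotpZr n k (x y : 'rV[R]_n) : dotp x (k *: y) = k * dotp x y.
Proof. by rewrite dotpC dotpZl dotpC. Qed.

Lemma dotp0l n (x : 'rV[R]_n) : dotp 0 x = 0.
Proof. by rewrite -(scale0r x) dotpZl mul0r. Qed.

Lemma measurable_dotpr n (y : 'rV[R]_n) :
  measurable_fun setT (fun z : T n => dotp y (row_of_tuple z)).
Proof.
apply: measurable_sum => i; apply: measurable_funM => //.
exact: measurable_coord.
Qed.

Lemma measurable_sqnorm n :
  measurable_fun setT (fun z : T n => dotp (row_of_tuple z) (row_of_tuple z)).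
Proof.
apply: measurable_sum => i.
by apply: measurable_funM; exact: measurable_coord.
Qed.

Lemma norm_cos_le1 (x : R) : `|cos x| <= 1.
Proof. by rewrite ler_norml cos_geN1 cos_le1. Qed.

Lemma norm_sin_le1 (x : R) : `|sin x| <= 1.
Proof. by rewrite ler_norml sin_geN1 sin_le1. Qed.

Lemma measurable_cosR : measurable_fun setT (@cos R).
Proof. exact: continuous_measurable_fun (@continuous_cos R). Qed.

Lemma measurable_sinR : measurable_fun setT (@sin R).
Proof. exact: continuous_measurable_fun (@continuous_sin R). Qed.

(** The heat multiplier at time [t]. *)
Definition gauss n (t : R) (x : 'rV[R]_n) : R := expR (- (t * dotp x x)).

Lemma gauss_ge0 n t (x : 'rV[R]_n) : 0 <= gauss t x.
Proof. exact: expR_ge0. Qed.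

Lemma measurable_gauss n t : measurable_fun setT (@gauss n t \o @row_of_tuple R n).
Proof.
apply: measurableT_comp => //; apply: measurableT_comp => //.
by apply: measurable_funM => //; exact: measurable_sqnorm.
Qed.

Lemma rapid_gauss n t : 0 < t -> rapid (@gauss n t).
Proof.
move=> t0; pose C := 2 * (1 + 2 / t ^+ 2).
have C0 : 0 <= C by rewrite mulr_ge0// addr_ge0// divr_ge0// sqr_ge0.
exists (C ^+ n); first by rewrite exprn_ge0.
move=> x; rewrite ger0_norm ?gauss_ge0// /gauss /dotp mulr_sumr -sumrN expR_sum.
have -> : C ^+ n = \prod_(i < n) C by rewrite prodr_const card_ord.
rewrite /weight -prodrXl -big_split/=; apply: ler_prod => i _.
rewrite expR_ge0/= -expr2.
have ty : 0 <= t * x 0 i ^+ 2 by rewrite mulr_ge0 ?(ltW t0) ?sqr_ge0.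
have := @expR_ge1Dxn R _ 1 ty; rewrite (_ : 2`!%:R = 2 :> R)// => e.
rewrite expRN /cauchy_weight exprVn -ler_pdivrMr ?invr_gt0 ?exprn_gt0// invrK.
rewrite mulrC ler_pdivrMr ?expR_gt0//.
apply: (@le_trans _ _ (C * (1 + (t * x 0 i ^+ 2) ^+ 2 / 2))); last first.
  by rewrite ler_wpM2l.
have -> : C * (1 + (t * x 0 i ^+ 2) ^+ 2 / 2) = 2 + 2 * (x 0 i ^+ 2) ^+ 2 +
    (4 / t ^+ 2 + (t * x 0 i ^+ 2) ^+ 2).
  by rewrite /C; field; rewrite gt_eqF.
have h1 : 0 <= (x 0 i ^+ 2 - 1) ^+ 2 by exact: sqr_ge0.
have h2 : 0 <= 4 / t ^+ 2 by rewrite divr_ge0// sqr_ge0.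
have h3 : 0 <= (t * x 0 i ^+ 2) ^+ 2 by exact: sqr_ge0.
rewrite /oneDsqr; lra.
Qed.

(** Along the ray r -> r *: y the transform [c] satisfies
    c' = - (r |y|^2 / (2 t)) c: its derivative is [- s], and [s] is computed from
    [c] by integrating the derivative of sin (r y.z + a) gauss t z along [y]. *)
Section ray.
Variables (n : nat) (t : R) (y : 'rV[R]_n) (a : R).
Hypothesis t0 : 0 < t.

Let c (r : R) : R :=
  \int[mu n]_z (cos (r * dotp y (row_of_tuple z) + a) * gauss t (row_of_tuple z)).

Let s (r : R) : R := \int[mu n]_z (dotp y (row_of_tuple z) *
  sin (r * dotp y (row_of_tuple z) + a) * gauss t (row_of_tuple z)).

Let gauss_le : exists2 C, 0 <= C & forall x : 'rV[R]_n, gauss t x <= C * weight x ^+ 2.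
Proof.
have [C C0 h] := rapid_gauss n t0; exists C => // x.
by have := h x; rewrite ger0_norm ?gauss_ge0.
Qed.

Let gauss_le1 : exists2 C, 0 <= C & forall (x : 'rV[R]_n) b, `|b| <= 1 ->
  `|b * gauss t x| <= C * weight x.
Proof.
have [C C0 h] := gauss_le; exists C => // x b b1.
rewrite normrM (ger0_norm (gauss_ge0 _ _)).
apply: (@le_trans _ _ (gauss t x)); first by rewrite ler_piMl ?gauss_ge0.
apply: le_trans (h x) _; rewrite ler_wpM2l// expr2 ler_piMr ?weight_ge0//.
exact: weight_le1.
Qed.

Let dotp_gauss_le : exists2 C, 0 <= C & forall (x : 'rV[R]_n) b, `|b| <= 1 ->
  `|dotp y x * b * gauss t x| <= C * weight x.
Proof.
have [C C0 h] := gauss_le; exists (C * \sum_i `|y 0 i|).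
  by rewrite mulr_ge0// sumr_ge0.
move=> x b b1; rewrite !normrM (ger0_norm (gauss_ge0 _ _)).
apply: (@le_trans _ _ (`|dotp y x| * (C * weight x ^+ 2))).
  by apply: ler_pM; rewrite ?mulr_ge0 ?gauss_ge0// ler_piMr.
have -> : `|dotp y x| * (C * weight x ^+ 2) =
    C * (`|dotp y x| * weight x) * weight x by ring.
by rewrite ler_wpM2r ?weight_ge0// ler_wpM2l// dotp_weight_le.
Qed.

Let mcos r : measurable_fun setT (fun z : T n =>
  cos (r * dotp y (row_of_tuple z) + a) * gauss t (row_of_tuple z)).
Proof.
apply: measurable_funM; last exact: measurable_gauss.
apply: (measurableT_comp measurable_cosR).
apply: measurable_funD => //; apply: measurable_funM => //.
exact: measurable_dotpr.
Qed.

Let msin r : measurable_fun setT (fun z : T n =>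
  sin (r * dotp y (row_of_tuple z) + a) * gauss t (row_of_tuple z)).
Proof.
apply: measurable_funM; last exact: measurable_gauss.
apply: (measurableT_comp measurable_sinR).
apply: measurable_funD => //; apply: measurable_funM => //.
exact: measurable_dotpr.
Qed.

Let derive_c (r : R) : is_derive r 1 c (- s r).
Proof.
have [C1 C10 h1] := gauss_le1; have [C2 C20 h2] := dotp_gauss_le.
have H := @is_derive_Rintegral _ (T n) R (mu n)
  (fun r z => cos (r * dotp y (row_of_tuple z) + a) * gauss t (row_of_tuple z))
  (fun r z => - (dotp y (row_of_tuple z) *
     sin (r * dotp y (row_of_tuple z) + a) * gauss t (row_of_tuple z)))
  (fun z => C2 * weight (row_of_tuple z)) r (r - 1) (r + 1).
apply: is_derive_eq.
  apply: H.
  - by rewrite ltrBlDr ltrDl ltr01.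
  - move=> k _; apply: (@integrable_weight_le R n
      (fun x => cos (k * dotp y x + a) * gauss t x) C1); first exact: mcos.
    by move=> x; apply: h1; exact: norm_cos_le1.
  - move=> k z _; apply: is_derive_eq.
    by rewrite /GRing.scale/=; ring.
  - exact: (integrableZl measurableT C2 (integrable_weight n)).
  - by move=> k z _; rewrite normrN; apply: h2; exact: norm_sin_le1.
rewrite /s -[RHS]mulN1r -RintegralZl//; last first.
  apply: (@integrable_weight_le R n
      (fun x => dotp y x * sin (r * dotp y x + a) * gauss t x) C2).
    under [X in measurable_fun _ X]eq_fun do rewrite /= -mulrA.
    by apply: measurable_funM; [exact: measurable_dotpr|exact: msin].
  by move=> x; apply: h2; exact: norm_sin_le1.
by apply: eq_Rintegral => z _; rewrite mulN1r.
Qed.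

Let sE (r : R) : s r = r * dotp y y / (2 * t) * c r.
Proof.
have [C1 C10 h1] := gauss_le1; have [C2 C20 h2] := dotp_gauss_le.
pose g x := sin (r * dotp y x + a) * gauss t x.
pose g1 x := cos (r * dotp y x + a) * gauss t x.
pose g2 x := dotp y x * sin (r * dotp y x + a) * gauss t x.
pose g' x := (r * dotp y y) * g1 x + (- (2 * t)) * g2 x.
have i1 : (mu n).-integrable setT (EFin \o (fun z => g1 (row_of_tuple z))).
  apply: (@integrable_weight_le R n _ C1); first exact: mcos.
  by move=> x; apply: h1; exact: norm_cos_le1.
have i2 : (mu n).-integrable setT (EFin \o (fun z => g2 (row_of_tuple z))).
  apply: (@integrable_weight_le R n _ C2).
    rewrite /g2; under [X in measurable_fun _ X]eq_fun do rewrite /= -mulrA.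
    by apply: measurable_funM; [exact: measurable_dotpr|exact: msin].
  by move=> x; apply: h2; exact: norm_sin_le1.
have : \int[mu n]_z g' (row_of_tuple z) = 0.
  apply: (@Rintegral_directional_derive0 R n g g' y
    (C1 + `|r * dotp y y| * C1 + 2 * t * C2)).
  - exact: msin.
  - move=> x; apply: (@le_trans _ _ (C1 * weight x)).
      by apply: h1; exact: norm_sin_le1.
    rewrite ler_wpM2r ?weight_ge0// -addrA lerDl addr_ge0// mulr_ge0// mulr_ge0//.
    exact: ltW.
  - move=> x h; rewrite /g /g' /g1 /g2 /gauss.
    have -> : (fun k : R => sin (r * dotp y (x + k *: y) + a) *
       expR (- (t * dotp (x + k *: y) (x + k *: y)))) =
       (fun k : R => sin (r * (dotp y x + k * dotp y y) + a) *
       expR (- (t * (dotp x x + (2 * dotp y x) * k + k * k * dotp y y)))).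
      apply/funext => k; congr (sin _ * expR _).
        by rewrite dotpDr dotpZr.
      by rewrite !(dotpDl, dotpDr, dotpZl, dotpZr) (dotpC x y); ring.
    apply: is_derive_eq.
    rewrite !(dotpDl, dotpDr, dotpZl, dotpZr) (dotpC x y) /GRing.scale/=.
    have -> : dotp x x + h * dotp y x + h * (dotp y x + h * dotp y y) =
      dotp x x + 2 * dotp y x * h + h * h * dotp y y by ring.
    by ring.
  - move=> x; apply: le_trans (ler_normD _ _) _.
    have -> : (C1 + `|r * dotp y y| * C1 + 2 * t * C2) * weight x = C1 * weight x +
      (`|r * dotp y y| * (C1 * weight x) + 2 * t * (C2 * weight x)) by ring.
    rewrite -[leLHS]add0r; apply: lerD; first by rewrite mulr_ge0 ?weight_ge0.
    apply: lerD; rewrite normrM.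
      by rewrite ler_wpM2l//; apply: h1; exact: norm_cos_le1.
    have t2 : 0 <= 2 * t by rewrite mulr_ge0// ltW.
    rewrite normrN (ger0_norm t2).
    by rewrite ler_wpM2l//; apply: h2; exact: norm_sin_le1.
rewrite /g' RintegralD//; last 2 first.
- exact: (integrableZl measurableT (r * dotp y y) i1).
- exact: (integrableZl measurableT (- (2 * t)) i2).
rewrite !RintegralZl// -/(c r) -/(s r) mulNr => /eqP; rewrite subr_eq0 => /eqP E.
have t2 : 2 * t != 0 by rewrite mulf_neq0// gt_eqF.
by apply: (mulfI t2); rewrite -E; field; rewrite gt_eqF.
Qed.

Let c_gauss : c 1 * expR (dotp y y / (4 * t)) = c 0.
Proof.
pose h (r : R) := c r * expR (r * r * (dotp y y / (4 * t))).
have -> : c 1 * expR (dotp y y / (4 * t)) = h 1 by rewrite /h !mul1r.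
have -> : c 0 = h 0 by rewrite /h !mul0r expR0 mulr1.
apply: is_derive_0_is_cst => r; rewrite /h.
have dc := derive_c r.
apply: is_derive_eq; rewrite /GRing.scale/= sE.
by field; rewrite gt_eqF.
Qed.

(** The phase [a] covers the cosine (a = 0) and the sine (a = pi / 2)
    transforms. *)
Lemma fourier_gauss :
  \int[mu n]_z (cos (dotp y (row_of_tuple z) + a) * gauss t (row_of_tuple z)) =
  cos a * Num.sqrt (pi / t) ^+ n * expR (- (dotp y y / (4 * t))).
Proof.
transitivity (c 1).
  by apply: eq_Rintegral => z _; rewrite mul1r.
apply: (@mulIf _ (expR (dotp y y / (4 * t)))); first by rewrite gt_eqF ?expR_gt0.
rewrite c_gauss -[RHS]mulrA [_ * expR (dotp _ _ / _)]mulrC expRxMexpNx_1 mulr1.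
rewrite /c; under eq_Rintegral do rewrite mul0r add0r.
have ig : (mu n).-integrable setT (EFin \o (fun z => gauss t (row_of_tuple z))).
  exact: (@rapid_integrable R n (gauss t) (@measurable_gauss n t) (@rapid_gauss n t t0)).
rewrite RintegralZl//; congr (_ * _); apply: Rintegral_EFin.
rewrite -(integral_gauss_tuple 0 t0); apply: eq_integral => z _.
congr (expR (- (t * _)))%:E; apply: eq_bigr => i _.
by rewrite !mxE sub0r mulrNN.
Qed.

End ray.
End gaussian_fourier.

(** * The Fourier transform with a phase *)
Section product_integrability.
Context d1 d2 (T1 : measurableType d1) (T2 : measurableType d2) (R : realType).
Variable m1 : {sigma_finite_measure set T1 -> \bar R}.
Variable m2 : {sigma_finite_measure set T2 -> \bar R}.

Lemma integrable_tensor (f1 : T1 -> R) (f2 : T2 -> R) (b : T1 * T2 -> R) :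
  m1.-integrable setT (EFin \o f1) -> m2.-integrable setT (EFin \o f2) ->
  measurable_fun setT b -> (forall p, `|b p| <= 1) ->
  (m1 \x m2)%E.-integrable setT (EFin \o (fun p => f1 p.1 * (b p * f2 p.2))).
Proof.
move=> i1 i2 mb b1.
have mf1 : measurable_fun setT f1.
  by have /measurable_int/measurable_EFinP := i1.
have mf2 : measurable_fun setT f2.
  by have /measurable_int/measurable_EFinP := i2.
have n1 := integrable_norm i1; have n2 := integrable_norm i2.
have mF : measurable_fun setT (fun p : T1 * T2 => f1 p.1 * (b p * f2 p.2)).
  apply: measurable_funM; first exact: measurable_comp_fst.
  by apply: measurable_funM => //; exact: measurable_comp_snd.
apply/integrable12ltyP; first exact/measurable_EFinP.
apply: (@le_lt_trans _ _ (\int[m1]_x (`|f1 x| * \int[m2]_y `|f2 y|)%:E)%E); last first.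
  rewrite integral_EFin_Rintegral ?ltry//.
  under eq_fun do rewrite /= mulrC.
  exact: (integrableZl measurableT _ n1).
apply: ge0_le_integral => //.
- by move=> x _; exact: integral_ge0.
- apply: (measurable_fun_fubini_tonelli_F
    (fun p => `|(f1 p.1 * (b p * f2 p.2))%:E|%E)) => //.
  by apply: measurableT_comp => //; exact/measurable_EFinP.
- apply/measurable_EFinP; apply: measurable_funM => //.
  exact: measurableT_comp.
move=> x _; rewrite EFinM -integral_EFin_Rintegral//.
rewrite -ge0_integralZl_EFin//; last first.
  by apply/measurable_EFinP; exact: measurableT_comp.
apply: ge0_le_integral => //.
- apply: measurableT_comp => //; apply/measurable_EFinP.
  exact: (measurableT_comp mF (measurable_pair1 x)).
- by apply: emeasurable_funM => //; apply/measurable_EFinP; exact: measurableT_comp.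
- move=> y _; rewrite /= -EFinM lee_fin !normrM ler_wpM2l//.
  by rewrite ler_piMl.
Qed.

End product_integrability.

Section phase_transform.
Context {R : realType}.
Local Notation mu n := (lebesgue_tuple R n).
Local Notation T n := (n.-tuple (measurableTypeR R)).

Lemma cos_lipschitz (x y : R) : `|cos x - cos y| <= `|x - y|.
Proof.
wlog xy : x y / y <= x.
  move=> H; have [|/ltW] := leP y x; first exact: H.
  by rewrite distrC (distrC x); exact: H.
have [c _ ->] : exists2 c, c \in `[y, x] & cos x - cos y = - sin c * (x - y).
  apply: MVT_segment => //.
  by apply: continuous_subspaceT; exact: continuous_cos.
by rewrite normrM normrN ler_piMl// norm_sin_le1.
Qed.

Lemma measurable_phase_dotp n (x : 'rV[R]_n) : measurable_fun setT
  (fun p : T n * T n => dotp (x - row_of_tuple p.2) (row_of_tuple p.1)).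
Proof.
apply: measurable_sum => i; apply: measurable_funM.
  rewrite (_ : (fun _ => _) = fun p : T n * T n => x 0 i - row_of_tuple p.2 0 i).
    apply: measurable_funB => //.
    exact: (@measurable_comp_snd _ _ _ (T n) (T n) _ _ (measurable_coord i)).
  by apply/funext => p; rewrite !mxE.
exact: (@measurable_comp_fst _ _ _ (T n) (T n) _ _ (measurable_coord i)).
Qed.

Lemma measurable_phase n (x : 'rV[R]_n) (a : R) : measurable_fun setT
  (fun p : T n * T n => cos (dotp (x - row_of_tuple p.2) (row_of_tuple p.1) + a)).
Proof.
apply: (measurableT_comp measurable_cosR); apply: measurable_funD => //.
exact: measurable_phase_dotp.
Qed.

Lemma measurable_dotp_subl n (x xi : 'rV[R]_n) :
  measurable_fun setT (fun z : T n => dotp (x - row_of_tuple z) xi).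
Proof.
rewrite (_ : (fun _ => _) = fun z : T n => dotp x xi - dotp xi (row_of_tuple z)).
  by apply: measurable_funB => //; exact: measurable_dotpr.
apply/funext => z; rewrite dotpDl -scaleN1r dotpZl mulN1r.
by rewrite (dotpC xi).
Qed.

(** With f = u + i v, the product exp (i x.xi) f^(xi) has real part
    phase_ft x 0 u xi + phase_ft x (pi / 2) v xi and imaginary part
    phase_ft x 0 v xi + phase_ft x (- pi / 2) u xi, up to normalization. *)
Definition phase_ft n (x : 'rV[R]_n) (a : R) (u : 'rV[R]_n -> R) (xi : 'rV[R]_n) : R :=
  \int[mu n]_z (cos (dotp (x - row_of_tuple z) xi + a) * u (row_of_tuple z)).

Section phase_ft_rapid.
Variables (n : nat) (x : 'rV[R]_n) (u : 'rV[R]_n -> R).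
Hypothesis mu_u : measurable_fun setT (u \o @row_of_tuple R n).
Hypothesis u_rapid : rapid u.

Let iu : (mu n).-integrable setT (EFin \o (fun z => u (row_of_tuple z))).
Proof. exact: rapid_integrable. Qed.

Lemma integrable_phase (b : R -> R) (xi : 'rV[R]_n) :
  measurable_fun setT b -> (forall r, `|b r| <= 1) ->
  (mu n).-integrable setT (EFin \o (fun z =>
    b (dotp (x - row_of_tuple z) xi) * u (row_of_tuple z))).
Proof.
move=> mb b1; apply: (@integrable_le_norm _ _ _ _ _
  (fun z => `|u (row_of_tuple z)|)).
- apply: measurable_funM => //; apply: (measurableT_comp mb).
  exact: measurable_dotp_subl.
- by move=> z; rewrite normrM ler_piMl.
- exact: (integrable_norm iu).
Qed.

Let mcosD a : measurable_fun setT (fun r : R => cos (r + a)).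
Proof. by apply: (measurableT_comp measurable_cosR); exact: measurable_funD. Qed.

Lemma integrable_phase_ft a (xi : 'rV[R]_n) :
  (mu n).-integrable setT (EFin \o (fun z =>
    cos (dotp (x - row_of_tuple z) xi + a) * u (row_of_tuple z))).
Proof.
apply: (@integrable_phase (fun r => cos (r + a))) => //.
by move=> r; exact: norm_cos_le1.
Qed.

Lemma phase_ft_le a xi :
  `|phase_ft x a u xi| <= \int[mu n]_z `|u (row_of_tuple z)|.
Proof.
apply: le_trans (le_normr_Rintegral _ (integrable_phase_ft a xi)) _ => //.
apply: le_Rintegral => //.
- exact: (integrable_norm (integrable_phase_ft a xi)).
- exact: (integrable_norm iu).
- by move=> z _; rewrite normrM ler_piMl// norm_cos_le1.
Qed.

(** Fubini gives the measurability after multiplication by the weight in [xi],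
    which makes the double integrand integrable. *)
Lemma measurable_phase_ft a :
  measurable_fun setT (phase_ft x a u \o @row_of_tuple R n).
Proof.
have H := @integrable_tensor _ _ (T n) (T n) R (mu n) (mu n) _ _ _
  (integrable_weight n) iu (measurable_phase x a) (fun p => norm_cos_le1 _).
have /= mF := measurable_fubini_F H.
rewrite (_ : _ \o _ = fun xi : T n => (weight (row_of_tuple xi))^-1 *
    fine (fubini_F (mu n) (EFin \o (fun p : T n * T n => weight (row_of_tuple p.1) *
    (cos (dotp (x - row_of_tuple p.2) (row_of_tuple p.1) + a) *
     u (row_of_tuple p.2)))) xi)).
  apply: measurable_funM; last exact: (measurableT_comp (@fine_measurable R setT measurableT) mF).
  rewrite (_ : (fun _ => _) = fun xi : T n => weight (row_of_tuple xi) `^ (- 1)).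
    by apply: (measurableT_comp (measurable_powR _)); exact: measurable_weight.
  by apply/funext => xi; rewrite powR_inv1 ?weight_ge0.
apply/funext => xi /=.
rewrite /fubini_F /= -[fine _]/(\int[mu n]_z (weight (row_of_tuple xi) *
  (cos (dotp (x - row_of_tuple z) (row_of_tuple xi) + a) * u (row_of_tuple z)))).
rewrite RintegralZl//; last exact: integrable_phase_ft.
by rewrite mulKf// gt_eqF ?weight_gt0.
Qed.

Lemma sum_abs_sub_weight (z : 'rV[R]_n) :
  (\sum_i `|x 0 i - z 0 i|) * weight z <= \sum_i (`|x 0 i| + 1).
Proof.
rewrite mulr_suml; apply: ler_sum => i _.
apply: (@le_trans _ _ ((`|x 0 i| + `|z 0 i|) * weight z)).
  by rewrite ler_wpM2r ?weight_ge0// ler_normB.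
by rewrite mulrDl lerD ?abs_coord_weight// ler_piMr ?weight_le1.
Qed.

Lemma abs_coord_enorm (xi : 'rV[R]_n) i : `|xi 0 i| <= enorm xi.
Proof.
rewrite /enorm -sqrtr_sqr ler_wsqrtr// /dotp (bigD1 i)//= expr2 lerDl.
by rewrite sumr_ge0// => j _; rewrite -expr2 sqr_ge0.
Qed.

(** If [u] has mean zero, cos a may be subtracted from the cosine. *)
Lemma phase_ft_lipschitz a : \int[mu n]_z u (row_of_tuple z) = 0 ->
  exists2 C, 0 <= C & forall xi, `|phase_ft x a u xi| <= C * enorm xi.
Proof.
move=> u0; have [C C0 uC] := u_rapid.
pose D := C * \sum_i (`|x 0 i| + 1).
have D0 : 0 <= D by rewrite mulr_ge0// sumr_ge0// => i _; rewrite addr_ge0.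
pose w := \int[mu n]_z weight (row_of_tuple z).
exists (D * w).
  by rewrite mulr_ge0// Rintegral_ge0// => z _; exact: weight_ge0.
move=> xi.
have -> : phase_ft x a u xi = \int[mu n]_z
   ((cos (dotp (x - row_of_tuple z) xi + a) - cos a) * u (row_of_tuple z)).
  under [RHS]eq_Rintegral do rewrite mulrBl.
  rewrite RintegralB//; last 2 first.
  - exact: integrable_phase_ft.
  - exact: (integrableZl measurableT (cos a) iu).
  by rewrite RintegralZl// u0 mulr0 subr0.
have bnd z : `|(cos (dotp (x - row_of_tuple z) xi + a) - cos a) *
     u (row_of_tuple z)| <= enorm xi * D * weight (row_of_tuple z).
  rewrite normrM.
  have h1 : `|cos (dotp (x - row_of_tuple z) xi + a) - cos a| <=
      enorm xi * \sum_i `|x 0 i - row_of_tuple z 0 i|.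
    apply: le_trans (cos_lipschitz _ _) _; rewrite addrK.
    apply: le_trans (ler_norm_sum _ _ _) _; rewrite mulr_sumr.
    apply: ler_sum => i _; rewrite normrM !mxE mulrC.
    by rewrite ler_wpM2r// abs_coord_enorm.
  apply: (le_trans (ler_pM _ _ h1 (uC _))) => //.
  have -> : enorm xi * (\sum_i `|x 0 i - row_of_tuple z 0 i|) *
    (C * weight (row_of_tuple z) ^+ 2) = enorm xi * C *
    ((\sum_i `|x 0 i - row_of_tuple z 0 i|) * weight (row_of_tuple z)) *
    weight (row_of_tuple z) by ring.
  rewrite ler_wpM2r ?weight_ge0// /D [enorm xi * (C * _)]mulrA.
  rewrite ler_wpM2l ?sum_abs_sub_weight//.
  by rewrite mulr_ge0 ?sqrtr_ge0.
have iB : (mu n).-integrable setT (EFin \o (fun z =>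
    enorm xi * D * weight (row_of_tuple z))).
  exact: (integrableZl measurableT _ (integrable_weight n)).
have iA : (mu n).-integrable setT (EFin \o (fun z =>
    (cos (dotp (x - row_of_tuple z) xi + a) - cos a) * u (row_of_tuple z))).
  apply: integrable_le_norm bnd iB; apply: measurable_funM => //.
  apply: measurable_funB => //; apply: (measurableT_comp (mcosD a)).
  exact: measurable_dotp_subl.
apply: le_trans (le_normr_Rintegral _ iA) _ => //.
apply: (@le_trans _ _ (\int[mu n]_z (enorm xi * D * weight (row_of_tuple z)))).
  apply: le_Rintegral => //.
  exact: (integrable_norm iA).
rewrite RintegralZl//; last exact: integrable_weight.
by rewrite -/w le_eqVlt; apply/orP; left; apply/eqP; ring.
Qed.

End phase_ft_rapid.

Lemma is_derive_line n (g : 'rV[R]_n -> R) (e p : 'rV[R]_n) (h : R) :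
  derivable g (p + h *: e) e ->
  is_derive h 1 (fun k : R => g (p + k *: e)) ('D_e g (p + h *: e)).
Proof.
move=> dg; have E : (fun k : R => k^-1 *: (g (p + (k *: (1 : R) + h) *: e) - g (p + h *: e)))
    = (fun k => k^-1 *: (g (k *: e + (p + h *: e)) - g (p + h *: e))).
  apply/funext => k; congr (_ *: (g _ - _)).
  by rewrite scalerDl [k *: 1]mulr1 addrCA.
apply: DeriveDef; first by rewrite /derivable /= E.
by rewrite /derive /= E.
Qed.

(** Integration by parts; the minus sign and the sine it produces are absorbed
    in the shift of the phase by pi / 2. *)
Lemma phase_ft_partial n (x xi : 'rV[R]_n) a (i : 'I_n) (g : 'rV[R]_n -> R) :
  let g' y := 'D_(delta_mx 0 i) g y in
  measurable_fun setT (g \o @row_of_tuple R n) -> rapid g ->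
  measurable_fun setT (g' \o @row_of_tuple R n) -> rapid g' ->
  (forall y, derivable g y (delta_mx 0 i)) ->
  phase_ft x a g' xi = xi 0 i * phase_ft x (a + pi / 2) g xi.
Proof.
move=> g' mg rg mg' rg' dg; pose e : 'rV[R]_n := delta_mx 0 i.
have [C C0 gC] := rapid_le_weight rg; have [D D0 gD] := rapid_le_weight rg'.
pose G y := cos (dotp (x - y) xi + a) * g y.
pose S y := sin (dotp (x - y) xi + a) * g y.
pose G1 y := cos (dotp (x - y) xi + a) * g' y.
pose G' y := xi 0 i * S y + G1 y.
have iG := integrable_phase_ft x mg rg a xi.
have iG1 := integrable_phase_ft x mg' rg' a xi.
have iS : (mu n).-integrable setT (EFin \o (fun z => S (row_of_tuple z))).
  apply: (@integrable_phase n x g mg rg (fun r => sin (r + a))).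
    by apply: (measurableT_comp measurable_sinR); exact: measurable_funD.
  by move=> r; exact: norm_sin_le1.
have e_xi : dotp e xi = xi 0 i.
  rewrite /dotp (bigD1 i)//= big1 ?addr0; first by rewrite mxE !eqxx mul1r.
  by move=> j ji; rewrite mxE (negbTE ji) andbF mul0r.
have lineE y k : dotp (x - (y + k *: e)) xi = dotp (x - y) xi - k * xi 0 i.
  have -> : x - (y + k *: e) = (x - y) + (- k) *: e by rewrite scaleNr opprD addrA.
  by rewrite dotpDl dotpZl e_xi mulNr.
have Z : \int[mu n]_z G' (row_of_tuple z) = 0.
  apply: (@Rintegral_directional_derive0 R n G G' e (C + `|xi 0 i| * C + D)).
  - by have /measurable_int/measurable_EFinP := iG.
  - move=> y; rewrite /G normrM; apply: (@le_trans _ _ `|g y|).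
      by rewrite ler_piMl// norm_cos_le1.
    apply: le_trans (gC y) _; rewrite ler_wpM2r ?weight_ge0//.
    by rewrite -addrA lerDl addr_ge0// mulr_ge0.
  - move=> y h; have dl := is_derive_line (dg (y + h *: e)).
    rewrite /G /G' /S /G1.
    have -> : (fun k : R => cos (dotp (x - (y + k *: e)) xi + a) * g (y + k *: e)) =
      (fun k : R => cos (dotp (x - y) xi - k * xi 0 i + a) * g (y + k *: e)).
      by apply/funext => k; rewrite lineE.
    apply: is_derive_eq.
    by rewrite lineE /g' /GRing.scale/=; ring.
  - move=> y; rewrite /G' /S /G1; apply: le_trans (ler_normD _ _) _.
    rewrite !normrM.
    have -> : (C + `|xi 0 i| * C + D) * weight y =
      C * weight y + (`|xi 0 i| * (C * weight y) + D * weight y) by ring.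
    rewrite -[leLHS]add0r; apply: lerD; first by rewrite mulr_ge0 ?weight_ge0.
    apply: lerD.
      rewrite ler_wpM2l//; apply: le_trans (gC y).
      by rewrite ler_piMl// norm_sin_le1.
    by apply: le_trans (gD y); rewrite ler_piMl// norm_cos_le1.
move: Z; rewrite /G' RintegralD//; last first.
  exact: (integrableZl measurableT _ iS).
rewrite RintegralZl// -/(phase_ft x a g' xi) => Z.
have -> : phase_ft x (a + pi / 2) g xi = - \int[mu n]_z S (row_of_tuple z).
  rewrite -mulN1r -RintegralZl//; apply: eq_Rintegral => z _.
  by rewrite addrA cosDpihalf mulN1r mulNr.
by apply/eqP; rewrite mulrN -addr_eq0 addrC Z.
Qed.

(** Iterated partial derivatives of a real function, in the order prescribed by
    the list. *)
Definition rpartials n (beta : seq 'I_n) (u : 'rV[R]_n -> R) : 'rV[R]_n -> R :=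
  foldr (fun i g y => 'D_(delta_mx 0 i) g y) u beta.

(** Real-valued Schwartz functions. *)
Definition rschwartz n (u : 'rV[R]_n -> R) : Prop :=
  [/\ forall beta, continuous (rpartials beta u),
      forall beta i y, derivable (rpartials beta u) y (delta_mx 0 i) &
      forall (alpha : 'I_n -> nat) beta, exists M : R, forall y,
        `|monomial alpha y| * `|rpartials beta u y| <= M].

Lemma rschwartz_rapid n (u : 'rV[R]_n -> R) beta : rschwartz u ->
  rapid (rpartials beta u).
Proof.
move=> [_ _ uM]; apply: rapid_of_monomials => S.
have [M hM] := uM (fun i => 4 * (i \in S))%N beta; exists M => y.
apply: le_trans (hM y); rewrite ler_wpM2r// /monomial.
rewrite big_mkcond/= normr_prod; apply: ler_prod => i _.
case: ifPn => iS; last by rewrite muln0 expr0 normr1 ler01 lexx.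
by rewrite muln1 exprn_even_ge0//= ger0_norm// exprn_even_ge0.
Qed.

Lemma rschwartz_measurable n (u : 'rV[R]_n -> R) beta : rschwartz u ->
  measurable_fun setT (rpartials beta u \o @row_of_tuple R n).
Proof. by move=> [cu _ _]; exact: measurable_continuous_row. Qed.

(** The phase [b] is a - (size beta) pi / 2. *)
Lemma phase_ft_rpartials n (x : 'rV[R]_n) (u : 'rV[R]_n -> R) beta a xi :
  rschwartz u -> exists b,
    phase_ft x b (rpartials beta u) xi = (\prod_(i <- beta) xi 0 i) * phase_ft x a u xi.
Proof.
move=> su; elim: beta => [|i beta [b E]].
  by exists a; rewrite big_nil mul1r.
exists (b - pi / 2); rewrite big_cons -mulrA -E.
rewrite -{2}(subrK (pi / 2) b).
apply: (@phase_ft_partial n x xi (b - pi / 2) i (rpartials beta u)).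
- exact: rschwartz_measurable.
- exact: rschwartz_rapid.
- exact: (@rschwartz_measurable n u (i :: beta)).
- exact: (@rschwartz_rapid n u (i :: beta)).
- by case: su.
Qed.

Lemma rapid_phase_ft n (x : 'rV[R]_n) (u : 'rV[R]_n -> R) a :
  rschwartz u -> rapid (phase_ft x a u).
Proof.
move=> su; apply: rapid_of_monomials => S.
pose beta := enum S ++ enum S ++ enum S ++ enum S.
exists (\int[mu n]_z `|rpartials beta u (row_of_tuple z)|) => xi.
have -> : \prod_(i in S) xi 0 i ^+ 4 = `|\prod_(i <- beta) xi 0 i|.
  rewrite /beta !big_cat/= !big_enum/= prodrXl; set p := \prod_(i in S) _.
  have -> : p * (p * (p * p)) = p ^+ 4 by ring.
  by rewrite ger0_norm// exprn_even_ge0.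
have [b E] := phase_ft_rpartials x beta a xi su.
rewrite -normrM -E; apply: phase_ft_le.
- exact: rschwartz_measurable.
- exact: rschwartz_rapid.
Qed.

End phase_transform.

(** * The kernel side: integrating the heat kernels over time *)
Section fubini_almost_everywhere.
Context d1 d2 (T1 : measurableType d1) (T2 : measurableType d2) (R : realType).
Variable m1 : {sigma_finite_measure set T1 -> \bar R}.
Variable m2 : {sigma_finite_measure set T2 -> \bar R}.

(** Fubini when the inner integral over [y] is known, and dominated, only for
    almost every [x]. *)
Lemma fubini_ae (F : T1 * T2 -> R) (k g : T1 -> R) :
  measurable_fun setT F -> measurable_fun setT k ->
  m1.-integrable setT (EFin \o g) ->
  {ae m1, forall x, (\int[m2]_y `|(F (x, y))%:E| <= (g x)%:E)%E} ->
  {ae m1, forall x, (\int[m2]_y (F (x, y))%:E)%E = (k x)%:E} ->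
  [/\ m1.-integrable setT (EFin \o k),
      m2.-integrable setT (fun y => \int[m1]_x (F (x, y))%:E)%E &
      (\int[m2]_y \int[m1]_x (F (x, y))%:E = \int[m1]_x (k x)%:E)%E].
Proof.
move=> mF mk ig Fg Fk.
have mFE : measurable_fun setT (EFin \o F) by exact/measurable_EFinP.
have mg : measurable_fun setT g by have /measurable_int/measurable_EFinP := ig.
have mnF : measurable_fun setT (fun x => \int[m2]_y `|(F (x, y))%:E|)%E.
  apply: (measurable_fun_fubini_tonelli_F (fun p => `|(F p)%:E|%E)) => //.
  exact: measurableT_comp.
have mgE : measurable_fun setT (fun x => `|(g x)%:E|%E).
  by apply: measurableT_comp => //; exact/measurable_EFinP.
have gfin : (\int[m1]_x `|(g x)%:E| < +oo)%E by have /integrableP[] := ig.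
have iF : (m1 \x m2)%E.-integrable setT (EFin \o F).
  apply/integrable12ltyP => //; apply: le_lt_trans gfin.
  apply: ae_ge0_le_integral => //.
  - by move=> x _; exact: integral_ge0.
  - by apply: filterS Fg => x H _; apply: le_trans H _; rewrite lee_fin ler_norm.
split.
- apply/integrableP; split; first exact/measurable_EFinP.
  apply: le_lt_trans gfin; apply: ae_ge0_le_integral => //.
  + by apply: measurableT_comp => //; exact/measurable_EFinP.
  + apply: filterS2 Fg Fk => x H1 H2 _.
    rewrite -[(EFin \o k) x]/((k x)%:E) -H2.
    apply: (@le_trans _ _ (g x)%:E); last by rewrite lee_fin ler_norm.
    apply: le_trans H1; apply: le_abse_integral => //.
    exact: (measurableT_comp mFE (measurable_pair1 x)).
- apply/integrableP; split; first exact: (measurable_fubini_G iF).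
  apply: le_lt_trans ((integrable21ltyP m1 m2 mFE).1 iF).
  apply: ge0_le_integral => //.
  + by apply: measurableT_comp => //; exact: (measurable_fubini_G iF).
  + apply: (measurable_fun_fubini_tonelli_G (fun p => `|(F p)%:E|%E)) => //.
    exact: measurableT_comp.
  + move=> y _; apply: le_abse_integral => //.
    exact: (measurableT_comp mFE (measurable_pair2 y)).
- rewrite -(Fubini iF); apply: ae_eq_integral => //.
  + exact: (measurable_fubini_F iF).
  + exact/measurable_EFinP.
  + by apply: filterS Fk => x H _.
Qed.

End fubini_almost_everywhere.

Section points.
Context {R : realType}.
Local Notation mu n := (lebesgue_tuple R n).
Local Notation T n := (n.-tuple (measurableTypeR R)).

(** Points are negligible: this removes the singularity of the kernel. *)
Lemma ae_sub_neq0 n (x : 'rV[R]_n) : (0 < n)%N ->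
  {ae mu n, forall z, x - row_of_tuple z != 0}.
Proof.
move=> n0; pose p : T n := [tuple (x 0 i : measurableTypeR R) | i < n].
have [mp mp0] := lebesgue_tuple_set1 p n0.
exists [set p]; split => // z /= /negP/negPn; rewrite subr_eq0 => /eqP xz.
by apply: eq_from_tnth => i; rewrite tnth_mktuple xz mxE.
Qed.

Lemma enorm_ge0 n (x : 'rV[R]_n) : 0 <= enorm x.
Proof. exact: sqrtr_ge0. Qed.

Lemma enorm_gt0 n (x : 'rV[R]_n) : x != 0 -> 0 < enorm x.
Proof. by move=> x0; rewrite sqrtr_gt0 dotp_gt0. Qed.

Lemma enorm_sqr n (x : 'rV[R]_n) : enorm x ^+ 2 = dotp x x.
Proof. by rewrite sqr_sqrtr// dotp_ge0. Qed.

Lemma enormN n (x : 'rV[R]_n) : enorm (- x) = enorm x.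
Proof. by congr Num.sqrt; apply: eq_bigr => i _; rewrite mxE mulrNN. Qed.

Lemma enorm_le_sum n (x : 'rV[R]_n) : enorm x <= \sum_i `|x 0 i|.
Proof.
have S0 : 0 <= \sum_i `|x 0 i| by exact: sumr_ge0.
rewrite -(ger0_norm S0) -sqrtr_sqr ler_wsqrtr// expr2 mulr_suml.
apply: ler_sum => i _; apply: (@le_trans _ _ (`|x 0 i| * `|x 0 i|)).
  by rewrite -normrM ler_norm.
by rewrite ler_wpM2l// (bigD1 i)//= lerDl sumr_ge0.
Qed.

End points.

Section gauss_phase.
Context {R : realType}.
Local Notation mu n := (lebesgue_tuple R n).
Local Notation T n := (n.-tuple (measurableTypeR R)).
Variables (n : nat) (x : 'rV[R]_n) (u : 'rV[R]_n -> R) (a : R).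
Hypothesis mu_u : measurable_fun setT (u \o @row_of_tuple R n).
Hypothesis u_rapid : rapid u.

Local Notation q z := (dotp (x - row_of_tuple z) (x - row_of_tuple z)).

Let iu : (mu n).-integrable setT (EFin \o (fun z => u (row_of_tuple z))).
Proof. exact: rapid_integrable. Qed.

(** The heat semigroup at [x] and time [t], up to normalization: multiplier on
    the left, kernel on the right. *)
Lemma gauss_phase_ft t : 0 < t ->
  \int[mu n]_xi (gauss t (row_of_tuple xi) * phase_ft x a u (row_of_tuple xi)) =
  cos a * Num.sqrt (pi / t) ^+ n *
    \int[mu n]_z (expR (- (q z / (4 * t))) * u (row_of_tuple z)).
Proof.
move=> t0.
have ig : (mu n).-integrable setT (EFin \o (fun xi => gauss t (row_of_tuple xi))).
  exact: (@rapid_integrable R n (gauss t) (@measurable_gauss R n t) (@rapid_gauss R n t t0)).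
have iF := @integrable_tensor _ _ (T n) (T n) R (mu n) (mu n) _ _ _
  ig iu (measurable_phase x a) (fun p => norm_cos_le1 _).
have := Fubini iF.
under eq_integral => xi _.
  rewrite (@integral_EFin_Rintegral _ _ _ _ (fun z => gauss t (row_of_tuple xi) *
    (cos (dotp (x - row_of_tuple z) (row_of_tuple xi) + a) * u (row_of_tuple z)))).
    rewrite RintegralZl//; last exact: integrable_phase_ft.
    over.
  exact: (integrableZl measurableT _ (integrable_phase_ft x mu_u u_rapid a (row_of_tuple xi))).
under [in X in _ = X -> _]eq_integral => z _.
  have icg : (mu n).-integrable setT (EFin \o (fun xi =>
      cos (dotp (x - row_of_tuple z) (row_of_tuple xi) + a) * gauss t (row_of_tuple xi))).
    apply: (@integrable_le_norm _ _ _ _ _ (fun xi => gauss t (row_of_tuple xi))) => //.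
    - apply: measurable_funM; last exact: measurable_gauss.
      apply: (measurableT_comp measurable_cosR); apply: measurable_funD => //.
      exact: measurable_dotpr.
    - move=> xi; rewrite normrM (ger0_norm (gauss_ge0 _ _)).
      by rewrite ler_piMl ?gauss_ge0// norm_cos_le1.
  have E xi : gauss t (row_of_tuple xi) *
      (cos (dotp (x - row_of_tuple z) (row_of_tuple xi) + a) * u (row_of_tuple z)) =
      u (row_of_tuple z) * (cos (dotp (x - row_of_tuple z) (row_of_tuple xi) + a) *
        gauss t (row_of_tuple xi)) by ring.
  under eq_integral do rewrite /= E.
  rewrite (@integral_EFin_Rintegral _ _ _ _ (fun xi => u (row_of_tuple z) *
    (cos (dotp (x - row_of_tuple z) (row_of_tuple xi) + a) * gauss t (row_of_tuple xi)))).
    rewrite RintegralZl// fourier_gauss//.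
    rewrite (_ : _ * _ = cos a * Num.sqrt (pi / t) ^+ n *
      (expR (- (q z / (4 * t))) * u (row_of_tuple z))); last by ring.
    over.
  exact: (integrableZl measurableT _ icg).
move=> /(congr1 fine) E.
rewrite -[LHS]/(fine _) E -[LHS]/(\int[mu n]_z (cos a * Num.sqrt (pi / t) ^+ n *
  (expR (- (q z / (4 * t))) * u (row_of_tuple z)))).
rewrite RintegralZl//.
apply: (@integrable_le_norm _ _ _ _ _ (fun z => `|u (row_of_tuple z)|)).
- apply: measurable_funM => //; apply: measurableT_comp => //.
  apply: measurableT_comp => //; apply: measurable_funM => //.
  exact: measurable_dotp_sub.
- move=> z; rewrite normrM ler_piMl// ger0_norm ?expR_ge0// expR_le1 oppr_le0.
  by rewrite divr_ge0 ?dotp_ge0// mulr_ge0// ltW.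
- exact: (integrable_norm iu).
Qed.

End gauss_phase.

Section real_representation.
Context {R : realType}.
Local Notation leb := (@lebesgue_measure R).
Local Notation mu n := (lebesgue_tuple R n).
Local Notation T n := (n.-tuple (measurableTypeR R)).
Variables (n : nat) (x : 'rV[R]_n) (u : 'rV[R]_n -> R) (s : R).
Hypothesis n0 : (0 < n)%N.
Hypothesis mu_u : measurable_fun setT (u \o @row_of_tuple R n).
Hypothesis u_rapid : rapid u.
Hypothesis s0 : 0 < s.
Hypothesis sn : s <= n%:R / 2.
Hypothesis u0 : s = n%:R / 2 -> \int[mu n]_z u (row_of_tuple z) = 0.

Local Notation q z := (dotp (x - row_of_tuple z) (x - row_of_tuple z)).
Local Notation U z := (u (row_of_tuple z)).

Let iu : (mu n).-integrable setT (EFin \o (fun z => U z)).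
Proof. exact: rapid_integrable. Qed.

Let mUfst : measurable_fun setT (fun p : T n * measurableTypeR R => U p.1).
Proof. exact: (@measurable_comp_fst _ _ _ (T n) (measurableTypeR R) _ _ mu_u). Qed.

Let mqfst : measurable_fun setT (fun p : T n * measurableTypeR R => q p.1).
Proof.
exact: (@measurable_comp_fst _ _ _ (T n) (measurableTypeR R) _ _
  (measurable_dotp_sub x)).
Qed.

Let msnd (g : R -> R) : measurable_fun setT g ->
  measurable_fun setT (fun p : T n * measurableTypeR R => g p.2).
Proof.
by move=> mg; exact: (@measurable_comp_snd _ _ _ (T n) (measurableTypeR R) _ g mg).
Qed.

Let mexpN : measurable_fun setT (fun r : R => expR (- r)).
Proof. exact: measurableT_comp. Qed.

(** The heat semigroup at [x] and time exp t, multiplied by exp (s t) and by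
    (4 pi)^(n/2), as a function of the logarithmic time [t]. *)
Definition heat_int (t : R) : R :=
  \int[mu n]_z (expR ((s - n%:R / 2) * t - q z / 4 * expR (- t)) * U z).

Let integrable_heat t : (mu n).-integrable setT (EFin \o (fun z =>
  expR ((s - n%:R / 2) * t - q z / 4 * expR (- t)) * U z)).
Proof.
apply: (@integrable_le_norm _ _ _ _ _
  (fun z => expR ((s - n%:R / 2) * t) * `|U z|)).
- apply: measurable_funM => //; apply: measurableT_comp => //.
  apply: measurable_funB => //; apply: measurable_funM => //.
  by apply: measurable_funM => //; exact: measurable_dotp_sub.
- move=> z; rewrite normrM ger0_norm ?expR_ge0// ler_wpM2r// ler_expR.
  by rewrite gerBl mulr_ge0 ?expR_ge0// divr_ge0 ?dotp_ge0.
- exact: (integrableZl measurableT _ (integrable_norm iu)).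
Qed.

Let kernel_const_gt0 : 0 < Gamma s * (4 * pi) `^ (n%:R / 2).
Proof. by rewrite mulr_gt0 ?Gamma_gt0 ?powR_gt0 ?mulr_gt0 ?pi_gt0. Qed.

Let q_gt0 z : x - row_of_tuple z != 0 -> 0 < q z / 4.
Proof. by move=> xz; rewrite divr_gt0 ?dotp_gt0. Qed.

Let mkernel : measurable_fun setT (fun z : T n => kernel_K s (x - row_of_tuple z)).
Proof.
rewrite /kernel_K; case: (s < n%:R / 2).
  apply: measurable_funM => //.
  rewrite (_ : (fun _ => _) = fun z : T n =>
    enorm (x - row_of_tuple z) `^ (- (n%:R - 2 * s))).
    exact: measurable_dotp_sub_powR.
  by apply/funext => z; rewrite powRN mul1r.
apply: measurable_funM => //; apply: measurable_funB => //.
apply: measurable_funM => //; apply: measurableT_comp => //.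
rewrite (_ : (fun _ => _) = fun z : T n => enorm (x - row_of_tuple z) `^ 1).
  exact: measurable_dotp_sub_powR.
by apply/funext => z; rewrite powRr1// enorm_ge0.
Qed.

Let C := Gamma s * (4 * pi) `^ (n%:R / 2).

(** Below the critical exponent the time integral of the heat kernel is the
    Riesz kernel. *)
Let kernel_side_lt : s < n%:R / 2 ->
  [/\ (mu n).-integrable setT (EFin \o (fun z =>
         C * (kernel_K s (x - row_of_tuple z) * U z))),
      leb.-integrable setT (EFin \o heat_int) &
      (\int[leb]_t (heat_int t)%:E =
       \int[mu n]_z (C * (kernel_K s (x - row_of_tuple z) * U z))%:E)%E].
Proof.
move=> slt; pose b := n%:R / 2 - s; have b0 : 0 < b by rewrite subr_gt0.
pose F (p : T n * measurableTypeR R) : R :=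
  expR ((s - n%:R / 2) * p.2 - q p.1 / 4 * expR (- p.2)) * U p.1.
have mF : measurable_fun setT F.
  apply: measurable_funM => //; apply: measurableT_comp => //.
  apply: measurable_funB.
    by apply: (@msnd (fun r => (s - n%:R / 2) * r)); exact: measurable_funM.
  by apply: measurable_funM; [exact: measurable_funM|exact: (msnd mexpN)].
have rieszE z : x - row_of_tuple z != 0 -> Gamma b * (q z / 4) `^ (- b) =
    C * kernel_K s (x - row_of_tuple z).
  move=> xz; rewrite /kernel_K slt /c_const -/b /C.
  rewrite powRM ?invr_ge0 ?dotp_ge0// -[4^-1]powR_inv1// -powRrM mulN1r opprK.
  have -> : q z `^ (- b) = (enorm (x - row_of_tuple z) `^ (n%:R - 2 * s))^-1.
    rewrite -powRN enorm_powR; congr (_ `^ _); rewrite /b; lra.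
  rewrite powRM ?pi_ge0// (_ : 4 `^ (n%:R / 2) = 4 `^ s * 4 `^ b); last first.
    by rewrite -powRD ?pnatr_eq0 ?implybT// /b addrC subrK.
  have h1 : 4 `^ s != 0 :> R by rewrite gt_eqF ?powR_gt0.
  have h2 : Gamma s != 0 by rewrite gt_eqF ?Gamma_gt0.
  have h3 : pi `^ (n%:R / 2) != 0 :> R by rewrite gt_eqF ?powR_gt0 ?pi_gt0.
  have h4 : enorm (x - row_of_tuple z) `^ (n%:R - 2 * s) != 0.
    by rewrite gt_eqF ?powR_gt0 ?enorm_gt0.
  (* The powers and the Gamma values are atoms for [field]. *)
  set e1 := 4 `^ s in h1 *; set e2 := Gamma s in h2 *.
  set e3 := pi `^ _ in h3 *; set e4 := _ `^ _ in h4 *.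
  set e5 := 4 `^ b; set e6 := Gamma b; clearbody e1 e2 e3 e4 e5 e6.
  by field; rewrite h1 h2 h3 h4.
have iexp z : x - row_of_tuple z != 0 ->
    (\int[leb]_t (expR ((s - n%:R / 2) * t - q z / 4 * expR (- t)))%:E)%E =
    (C * kernel_K s (x - row_of_tuple z))%:E.
  move=> xz; rewrite -(rieszE z xz) -(integral_gamma_exp_invscale b0 (q_gt0 xz)).
  by apply: eq_integral => t _; rewrite /b opprB.
have mexp z : measurable_fun setT (fun t : R =>
    expR ((s - n%:R / 2) * t - q z / 4 * expR (- t))).
  apply: measurableT_comp => //; apply: measurable_funB; first exact: measurable_funM.
  exact: measurable_funM.
have [D D0 uD] := rapid_le_weight u_rapid.
have aeN := ae_sub_neq0 x n0.
have ns0 : 0 < n%:R - 2 * s by move: slt; lra.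
have nsn : n%:R - 2 * s < n%:R by rewrite gtrBl mulr_gt0.
pose g z := `|C * c_const n s| * D *
  (enorm (x - row_of_tuple z) `^ (- (n%:R - 2 * s)) * weight (row_of_tuple z)).
have ig : (mu n).-integrable setT (EFin \o g).
  exact: (integrableZl measurableT (`|C * c_const n s| * D)
    (@integrable_enorm_weight R n x _ ns0 nsn)).
have mk : measurable_fun setT (fun z : T n =>
    C * (kernel_K s (x - row_of_tuple z) * U z)).
  by apply: measurable_funM => //; apply: measurable_funM.
have iexpi z : x - row_of_tuple z != 0 -> leb.-integrable setT (EFin \o (fun t =>
    expR ((s - n%:R / 2) * t - q z / 4 * expR (- t)))).
  move=> xz; apply: (@ge0_integrable_EFin _ (measurableTypeR R) _ leb _
    (C * kernel_K s (x - row_of_tuple z))) => //.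
  - exact: mexp.
  - exact: iexp.
have Fg : {ae mu n, forall z, (\int[leb]_t `|(F (z, t))%:E| <= (g z)%:E)%E}.
  apply: filterS aeN => z xz.
  under eq_integral => t _ do rewrite /F/= normrM EFinM ger0_norm ?expR_ge0//.
  rewrite ge0_integralZr//; 
    last by apply/measurable_EFinP; exact: mexp.
  rewrite iexp// -EFinM lee_fin.
  have : 0 <= C * kernel_K s (x - row_of_tuple z).
    by rewrite -(rieszE z xz) mulr_ge0 ?powR_ge0// ltW// Gamma_gt0.
  rewrite /kernel_K slt mul1r -powRN mulrA => K0.
  have e0 : 0 <= enorm (x - row_of_tuple z) `^ (- (n%:R - 2 * s)) by exact: powR_ge0.
  apply: (@le_trans _ _ (`|C * c_const n s| *
    enorm (x - row_of_tuple z) `^ (- (n%:R - 2 * s)) * (D * weight (row_of_tuple z)))).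
    by apply: ler_pM => //; rewrite ler_wpM2r// ler_norm.
  by rewrite /g le_eqVlt; apply/orP; left; apply/eqP; ring.
have Fk : {ae mu n, forall z, (\int[leb]_t (F (z, t))%:E)%E =
    (C * (kernel_K s (x - row_of_tuple z) * U z))%:E}.
  apply: filterS aeN => z xz.
  under eq_integral => t _ do rewrite /F/= EFinM.
  rewrite integralZr//; last exact: iexpi.
  by rewrite iexp// -EFinM mulrA.
have [H1 H2 H3] := @fubini_ae _ _ (T n) (measurableTypeR R) R (mu n) leb F
  _ _ mF mk ig Fg Fk.
have HE : (fun t => \int[mu n]_z (F (z, t))%:E)%E = EFin \o heat_int.
  by apply/funext => t /=; rewrite (integral_EFin_Rintegral (integrable_heat t)).
by split => //; [rewrite -HE|rewrite -H3 HE].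
Qed.

(** At the critical exponent [heat_int] is unchanged when the indicator of
    t > 0 is subtracted from the heat kernel, because [u] has mean zero. *)
Let kernel_side_eq : s = n%:R / 2 ->
  [/\ (mu n).-integrable setT (EFin \o (fun z =>
         C * (kernel_K s (x - row_of_tuple z) * U z))),
      leb.-integrable setT (EFin \o heat_int) &
      (\int[leb]_t (heat_int t)%:E =
       \int[mu n]_z (C * (kernel_K s (x - row_of_tuple z) * U z))%:E)%E].
Proof.
move=> sE; have u00 := u0 sE.
pose F (p : T n * measurableTypeR R) : R := log_heat (q p.1 / 4) p.2 * U p.1.
have mF : measurable_fun setT F.
  apply: measurable_funM => //; rewrite /log_heat; apply: measurable_funB.
    apply: measurableT_comp => //; apply: measurableT_comp => //.
    by apply: measurable_funM; [exact: measurable_funM|exact: (msnd mexpN)].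
  exact: (msnd measurable_gt0).
pose L1 := \int[leb]_t log_exp t; pose L1n := \int[leb]_t `|log_exp t|.
pose k z := (L1 - ln (q z / 4)) * U z.
have L1n0 : 0 <= L1n by apply: Rintegral_ge0.
have [D D0 uD] := u_rapid.
have lnE z : x - row_of_tuple z != 0 ->
    ln (q z / 4) = 2 * ln (enorm (x - row_of_tuple z)) - ln 4.
  move=> xz; rewrite ln_div ?posrE ?dotp_gt0//.
  by rewrite -enorm_sqr lnXn ?enorm_gt0// mulr_natl.
have kE z : x - row_of_tuple z != 0 ->
    k z = C * (kernel_K s (x - row_of_tuple z) * U z) +
      (L1 + ln 4 + euler_gamma R) * U z.
  move=> xz; rewrite /k lnE// /kernel_K sE ltxx /C -sE.
  have h1 : Gamma s != 0 by rewrite gt_eqF ?Gamma_gt0.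
  have h2 : (4 * pi) `^ s != 0 :> R by rewrite gt_eqF ?powR_gt0 ?mulr_gt0 ?pi_gt0.
  by field; rewrite h1 h2.
have mk : measurable_fun setT k.
  apply: measurable_funM => //; apply: measurable_funB => //.
  apply: measurableT_comp => //; apply: measurable_funM => //.
  exact: measurable_dotp_sub.
have n1 : 2^-1 < n%:R :> R.
  by apply: (@lt_le_trans _ _ 1); [rewrite invf_lt1 ?ltr1n|rewrite ler1n].
have aeN := ae_sub_neq0 x n0.
(* [g] dominates: |ln r| <= 2 (1 + r) + 2 r^(-1/2), and (1 + |x - z|) w(z) <= B. *)
pose B := 1 + \sum_i (`|x 0 i| + 1).
pose g z := (L1n + ln 4 + 4 * B) * D * weight (row_of_tuple z) +
  4 * D * (enorm (x - row_of_tuple z) `^ (- 2^-1) * weight (row_of_tuple z)).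
have ig : (mu n).-integrable setT (EFin \o g).
  have := integrableD measurableT
    (integrableZl measurableT ((L1n + ln 4 + 4 * B) * D) (integrable_weight n))
    (integrableZl measurableT (4 * D)
      (@integrable_enorm_weight R n x 2^-1 _ n1)).
  by apply; rewrite invr_gt0.
have ln4 : 0 <= ln 4 :> R by rewrite ln_ge0// ler1n.
have absln (r : R) : 0 < r -> `|ln r| <= 2 * (1 + r) + 2 * r `^ (- 2^-1).
  move=> r0; have rp v : 0 < r `^ v by exact: powR_gt0.
  have h1 : ln r <= 2 * r `^ 2^-1.
    have := ln_sublinear (rp 2^-1); rewrite ln_powR; lra.
  have h2 : - ln r <= 2 * r `^ (- 2^-1).
    have := ln_sublinear (rp (- 2^-1)); rewrite ln_powR; lra.
  have h3 : r `^ 2^-1 <= 1 + r.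
    rewrite powR12_sqrt ?(ltW r0)//; have sr := sqrtr_ge0 r.
    have : Num.sqrt r ^+ 2 = r by rewrite sqr_sqrtr// ltW.
    have : 0 <= (Num.sqrt r - 2^-1) ^+ 2 by exact: sqr_ge0.
    lra.
  have := rp (- 2^-1); have := rp 2^-1; rewrite ler_norml; lra.
have gE z : x - row_of_tuple z != 0 -> (L1n + `|ln (q z / 4)|) * `|U z| <= g z.
  move=> xz; set r := enorm (x - row_of_tuple z); set w := weight (row_of_tuple z).
  have w0 : 0 <= w by exact: weight_ge0.
  have r0 : 0 < r by exact: enorm_gt0.
  have h1 : `|ln (q z / 4)| <= ln 4 + 4 * (1 + r) + 4 * r `^ (- 2^-1).
    rewrite lnE// -/r; apply: le_trans (ler_normB _ _) _.
    rewrite normrM [X in _ + X]ger0_norm// [X in X * _]ger0_norm//.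
    have := absln r r0; lra.
  have h2 : (1 + r) * w <= B.
    rewrite mulrDl mul1r lerD ?weight_le1//.
    apply: le_trans (sum_abs_sub_weight x (row_of_tuple z)).
    rewrite ler_wpM2r//; apply: le_trans (enorm_le_sum _) _.
    by apply: ler_sum => i _; rewrite !mxE.
  have p0 : 0 <= r `^ (- 2^-1) by exact: powR_ge0.
  apply: (@le_trans _ _ ((L1n + (ln 4 + 4 * (1 + r) + 4 * r `^ (- 2^-1))) * (D * w ^+ 2))).
    by apply: ler_pM => //; rewrite ?addr_ge0// lerD.
  have -> : (L1n + (ln 4 + 4 * (1 + r) + 4 * r `^ (- 2^-1))) * (D * w ^+ 2) =
    (L1n + ln 4) * D * w * w + 4 * ((1 + r) * w) * D * w +
    4 * D * (r `^ (- 2^-1) * w) * w by ring.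
  rewrite /g -/r -/w; apply: lerD.
    have -> : (L1n + ln 4 + 4 * B) * D * w =
      (L1n + ln 4) * D * w + 4 * B * D * w by ring.
    apply: lerD.
      by rewrite ler_piMr ?weight_le1// !mulr_ge0// addr_ge0.
    by rewrite !ler_wpM2r// ler_wpM2l.
  by rewrite ler_piMr ?weight_le1// !mulr_ge0.
have iLH z : x - row_of_tuple z != 0 ->
    leb.-integrable setT (EFin \o log_heat (q z / 4)).
  move=> xz; apply/integrableP; split.
    by apply/measurable_EFinP; exact: measurable_log_heat.
  exact: le_lt_trans (integral_norm_log_heat (q_gt0 xz)) (ltry _).
have Fg : {ae mu n, forall z, (\int[leb]_t `|(F (z, t))%:E| <= (g z)%:E)%E}.
  apply: filterS aeN => z xz.
  under eq_integral => t _ do rewrite /F/= normrM EFinM.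
  rewrite ge0_integralZr//; last first.
    apply: (@measurableT_comp _ _ _ _ _ _ (@abse R) _ (EFin \o log_heat (q z / 4))) => //.
    by apply/measurable_EFinP; exact: measurable_log_heat.
  apply: (@le_trans _ _ ((L1n + `|ln (q z / 4)|) * `|U z|)%:E); last by rewrite lee_fin gE.
  rewrite EFinM lee_wpmul2r ?lee_fin//.
  exact: integral_norm_log_heat (q_gt0 xz).
have Fk : {ae mu n, forall z, (\int[leb]_t (F (z, t))%:E)%E = (k z)%:E}.
  apply: filterS aeN => z xz.
  under eq_integral => t _ do rewrite /F/= EFinM.
  rewrite integralZr//; last exact: iLH.
  by rewrite (integral_log_heat (q_gt0 xz)) -EFinM.
have [H1 H2 H3] := @fubini_ae _ _ (T n) (measurableTypeR R) R (mu n) leb F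
  _ _ mF mk ig Fg Fk.
have HE : (fun t => \int[mu n]_z (F (z, t))%:E)%E = EFin \o heat_int.
  apply/funext => t /=; have iH := integrable_heat t.
  have iH0 : (mu n).-integrable setT (EFin \o (fun z => (0 < t)%R%:R * U z)).
    exact: (integrableZl measurableT (0 < t)%R%:R iu).
  (* The exponent s - n/2 vanishes; the indicator integrates against [u] to 0. *)
  transitivity (\int[mu n]_z (expR ((s - n%:R / 2) * t - q z / 4 * expR (- t)) * U z -
      (0 < t)%R%:R * U z)%:E)%E.
    apply: eq_integral => z _; rewrite /F /log_heat /= mulrBl sE subrr mul0r sub0r.
    by [].
  under eq_integral do rewrite EFinB.
  rewrite integralB//.
  rewrite (integral_EFin_Rintegral iH) (integral_EFin_Rintegral iH0).
  by rewrite RintegralZl// u00 mulr0 sube0.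
have ikE : (mu n).-integrable setT (EFin \o (fun z => k z -
    (L1 + ln 4 + euler_gamma R) * U z)).
  have := integrableB measurableT H1
    (integrableZl measurableT (L1 + ln 4 + euler_gamma R) iu).
  by [].
have mK : measurable_fun setT (fun z : T n =>
    C * (kernel_K s (x - row_of_tuple z) * U z)).
  by apply: measurable_funM => //; apply: measurable_funM.
have aeK : {ae mu n, forall z, k z - (L1 + ln 4 + euler_gamma R) * U z =
    C * (kernel_K s (x - row_of_tuple z) * U z)}.
  by apply: filterS aeN => z xz; rewrite kE// addrK.
split.
- apply/integrableP; split; first exact/measurable_EFinP.
  have /integrableP[mk' kfin] := ikE; apply: le_lt_trans kfin.
  apply: ae_ge0_le_integral => //.
  + by apply: measurableT_comp => //; exact/measurable_EFinP.
  + exact: measurableT_comp.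
  + by apply: filterS aeK => z E _; rewrite /= E.
- by rewrite -HE.
- rewrite -[LHS]/(\int[leb]_t (EFin \o heat_int) t)%E -HE H3.
  transitivity (\int[mu n]_z (k z - (L1 + ln 4 + euler_gamma R) * U z)%:E)%E.
    under [RHS]eq_integral do rewrite EFinB.
    rewrite integralB//; last exact: (integrableZl measurableT _ iu).
    rewrite [X in (_ - X)%E]integral_EFin_Rintegral; last exact: (integrableZl measurableT _ iu).
    by rewrite RintegralZl// u00 mulr0 sube0.
  apply: ae_eq_integral => //.
  + by have /integrableP[] := ikE.
  + exact/measurable_EFinP.
  + by apply: filterS aeK => z E _; rewrite E.
Qed.

Lemma kernel_side :
  [/\ (mu n).-integrable setT (EFin \o (fun z =>
         kernel_K s (x - row_of_tuple z) * U z)),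
      leb.-integrable setT (EFin \o heat_int) &
      \int[leb]_t heat_int t = Gamma s * (4 * pi) `^ (n%:R / 2) *
        \int[mu n]_z (kernel_K s (x - row_of_tuple z) * U z)].
Proof.
have [H1 H2 H3] : [/\ (mu n).-integrable setT (EFin \o (fun z =>
         C * (kernel_K s (x - row_of_tuple z) * U z))),
      leb.-integrable setT (EFin \o heat_int) &
      (\int[leb]_t (heat_int t)%:E =
       \int[mu n]_z (C * (kernel_K s (x - row_of_tuple z) * U z))%:E)%E].
  have [slt|] := ltP s (n%:R / 2); first exact: kernel_side_lt.
  by move=> sge; apply: kernel_side_eq; apply: le_anti; rewrite sn.
have iK : (mu n).-integrable setT (EFin \o (fun z =>
    kernel_K s (x - row_of_tuple z) * U z)).
  have := integrableZl measurableT C^-1 H1; apply: eq_integrable => // z _ /=.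
  by rewrite -EFinM mulKf// gt_eqF.
split => //; rewrite -/C -RintegralZl//.
by rewrite /Rintegral H3.
Qed.

End real_representation.

(** * The spectral side, and the real representation formula *)
Section spectral_representation.
Context {R : realType}.
Local Notation leb := (@lebesgue_measure R).
Local Notation mu n := (lebesgue_tuple R n).
Local Notation T n := (n.-tuple (measurableTypeR R)).
Variables (n : nat) (x : 'rV[R]_n) (u : 'rV[R]_n -> R) (s a : R).
Hypothesis n0 : (0 < n)%N.
Hypothesis su : rschwartz u.
Hypothesis s0 : 0 < s.
Hypothesis sn : s <= n%:R / 2.
Hypothesis u0 : s = n%:R / 2 -> \int[mu n]_z u (row_of_tuple z) = 0.

Local Notation A xi := (phase_ft x a u (row_of_tuple xi)).

Let mu_u : measurable_fun setT (u \o @row_of_tuple R n).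
Proof. exact: (@rschwartz_measurable R n u [::]). Qed.

Let u_rapid : rapid u.
Proof. exact: (@rschwartz_rapid R n u [::]). Qed.

Let mA : measurable_fun setT (fun xi : T n => A xi).
Proof. exact: measurable_phase_ft. Qed.

Let A_rapid : rapid (phase_ft x a u).
Proof. exact: rapid_phase_ft. Qed.

Let integrable_enorm0_weight r : 0 < r -> r < n%:R ->
  (mu n).-integrable setT (EFin \o (fun xi =>
    enorm (row_of_tuple xi) `^ (- r) * weight (row_of_tuple xi))).
Proof.
move=> r0 rn; rewrite (_ : (fun xi => _) = fun xi : T n =>
  enorm (0 - row_of_tuple xi) `^ (- r) * weight (row_of_tuple xi)).
  exact: integrable_enorm_weight.
by apply/funext => xi; rewrite sub0r enormN.
Qed.

(** At the critical exponent, the geometric mean of the bounds C w^2 and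
    D |xi| on the transform leaves |xi|^(- (n - 1/2)) w(xi). *)
Let multiplier_bound : exists2 g : T n -> R, (mu n).-integrable setT (EFin \o g) &
  forall xi, enorm (row_of_tuple xi) `^ (- (2 * s)) * `|A xi| <= g xi.
Proof.
have s2 : 0 < 2 * s by rewrite mulr_gt0.
have [slt|sge] := ltP s (n%:R / 2).
  have [D D0 hD] := rapid_le_weight A_rapid.
  exists (fun xi => D * (enorm (row_of_tuple xi) `^ (- (2 * s)) *
      weight (row_of_tuple xi))).
    apply: (integrableZl measurableT D (integrable_enorm0_weight s2 _)).
    by move: slt; lra.
  by move=> xi; rewrite mulrCA ler_wpM2l ?powR_ge0.
have sE : s = n%:R / 2 by apply: le_anti; rewrite sn.
have n1 : 1 <= n%:R :> R by rewrite ler1n.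
have [C C0 hC] := A_rapid.
have [D D0 hD] := phase_ft_lipschitz x mu_u u_rapid a (u0 sE).
pose r : R := n%:R - 2^-1.
have r0 : 0 < r by rewrite /r; lra.
have rn : r < n%:R by rewrite /r; lra.
exists (fun xi => Num.sqrt (C * D) * (enorm (row_of_tuple xi) `^ (- r) *
    weight (row_of_tuple xi))).
  exact: (integrableZl measurableT _ (integrable_enorm0_weight r0 rn)).
move=> xi; set y := row_of_tuple xi; have e0 := enorm_ge0 y.
have w0 := weight_ge0 y.
have hA : `|phase_ft x a u y| <= Num.sqrt (C * D) * weight y * enorm y `^ 2^-1.
  rewrite -ler_sqr ?nnegrE ?mulr_ge0 ?sqrtr_ge0 ?powR_ge0//.
  rewrite powR12_sqrt// !exprMn !sqr_sqrtr ?mulr_ge0//.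
  have -> : C * D * weight y ^+ 2 * enorm y = (C * weight y ^+ 2) * (D * enorm y) by ring.
  by rewrite expr2 ler_pM.
apply: (le_trans (ler_wpM2l (powR_ge0 _ _) hA)).
have [->|y0] := eqVneq (enorm y) 0.
  rewrite [0 `^ (- (2 * s))]powR0 ?mul0r ?mulr_ge0 ?sqrtr_ge0 ?powR_ge0//.
  by rewrite oppr_eq0 gt_eqF.
have -> : enorm y `^ (- r) = enorm y `^ (- (2 * s)) * enorm y `^ 2^-1.
  rewrite -powRD ?y0 ?implybT//; congr (_ `^ _); rewrite /r sE; lra.
by rewrite le_eqVlt; apply/orP; left; apply/eqP; ring.
Qed.

Let F (p : T n * measurableTypeR R) : R :=
  expR (s * p.2 - dotp (row_of_tuple p.1) (row_of_tuple p.1) * expR p.2) * A p.1.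

Let msqfst : measurable_fun setT (fun p : T n * measurableTypeR R =>
  dotp (row_of_tuple p.1) (row_of_tuple p.1)).
Proof.
exact: (@measurable_comp_fst _ _ _ (T n) (measurableTypeR R) _
  (fun z => dotp (row_of_tuple z) (row_of_tuple z)) (@measurable_sqnorm R n)).
Qed.

Let mF : measurable_fun setT F.
Proof.
apply: measurable_funM; last first.
  exact: (@measurable_comp_fst _ _ _ (T n) (measurableTypeR R) _ _ mA).
apply: measurableT_comp => //; apply: measurable_funB; first exact: measurable_funM.
apply: measurable_funM.
  exact: msqfst.
exact: (@measurable_comp_snd _ _ _ (T n) (measurableTypeR R) _ _ (@measurable_expR R)).
Qed.

Let mpow : measurable_fun setT (fun xi : T n => enorm (row_of_tuple xi) `^ (- (2 * s))).
Proof.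
rewrite (_ : (fun _ => _) = fun xi : T n => enorm (0 - row_of_tuple xi) `^ (- (2 * s))).
  exact: measurable_dotp_sub_powR.
by apply/funext => xi; rewrite sub0r enormN.
Qed.

(** At each time the spectral integral is a value of the heat semigroup. *)
Let int_gauss_phase t :
  (\int[mu n]_xi (F (xi, t))%:E)%E =
  (cos a * Num.sqrt pi ^+ n * heat_int x u s t)%:E.
Proof.
have et := expR_gt0 t.
have iGA : (mu n).-integrable setT (EFin \o (fun xi =>
    gauss (expR t) (row_of_tuple xi) * A xi)).
  have [D D0 hD] := rapid_le_weight A_rapid.
  apply: (@integrable_weight_le R n (fun y => gauss (expR t) y * phase_ft x a u y) D).
    by apply: measurable_funM => //; exact: measurable_gauss.
  move=> y; rewrite normrM (ger0_norm (gauss_ge0 _ _)); apply: le_trans (hD y).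
  by rewrite ler_piMl// /gauss expR_le1 oppr_le0 mulr_ge0 ?dotp_ge0// expR_ge0.
have iU := rapid_integrable mu_u u_rapid.
have FE xi : F (xi, t) = expR (s * t) * (gauss (expR t) (row_of_tuple xi) * A xi).
  by rewrite /F/= expRD mulrA /gauss [expR t * dotp _ _]mulrC.
under eq_integral do rewrite FE.
rewrite (integral_EFin_Rintegral (integrableZl measurableT (expR (s * t)) iGA)).
rewrite RintegralZl// (gauss_phase_ft x a mu_u u_rapid et); congr EFin.
have -> : heat_int x u s t = expR ((s - n%:R / 2) * t) *
    \int[mu n]_z (expR (- (dotp (x - row_of_tuple z) (x - row_of_tuple z) /
      (4 * expR t))) * u (row_of_tuple z)).
  rewrite -RintegralZl//.
    apply: eq_Rintegral => z _; rewrite mulrA -expRD; congr (expR (_ - _) * _).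
    by rewrite expRN invfM mulrA.
  apply: (@integrable_le_norm _ _ _ _ _ (fun z => `|u (row_of_tuple z)|)).
  - apply: measurable_funM => //; apply: measurableT_comp => //.
    apply: measurableT_comp => //; apply: measurable_funM => //.
    exact: measurable_dotp_sub.
  - move=> z; rewrite normrM ger0_norm ?expR_ge0// ler_piMl// expR_le1 oppr_le0.
    by rewrite divr_ge0 ?dotp_ge0// mulr_ge0// ltW.
  - exact: (integrable_norm iU).
have -> : Num.sqrt (pi / expR t) ^+ n = Num.sqrt pi ^+ n * expR (- (n%:R / 2 * t)).
  rewrite sqrtrM ?pi_ge0// exprMn; congr (_ * _).
  by rewrite -expRN -(powR12_sqrt (expR_ge0 (- t))) -expRM -expRM_natl; congr expR; ring.
have -> : expR ((s - n%:R / 2) * t) = expR (s * t) * expR (- (n%:R / 2 * t)).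
  by rewrite -expRD; congr expR; ring.
ring.
Qed.

Lemma integrable_multiplier : (mu n).-integrable setT (EFin \o (fun xi =>
  enorm (row_of_tuple xi) `^ (- (2 * s)) * A xi)).
Proof.
have [g ig gA] := multiplier_bound; apply: integrable_le_norm ig.
  exact: measurable_funM.
by move=> xi; rewrite normrM ger0_norm ?powR_ge0.
Qed.

Let spectral_side :
  (\int[leb]_t (cos a * Num.sqrt pi ^+ n * heat_int x u s t)%:E =
   \int[mu n]_xi (Gamma s * (enorm (row_of_tuple xi) `^ (- (2 * s)) * A xi))%:E)%E.
Proof.
have [g ig gA] := multiplier_bound.
have G0 : 0 <= Gamma s by rewrite ltW// Gamma_gt0.
have aeN : {ae mu n, forall xi, row_of_tuple xi != 0 :> 'rV[R]_n}.
  have := ae_sub_neq0 (0 : 'rV[R]_n) n0; apply: filterS => xi.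
  by rewrite sub0r oppr_eq0.
have mexp (y : 'rV[R]_n) : measurable_fun setT (fun t : R =>
    expR (s * t - dotp y y * expR t)).
  by apply: measurableT_comp => //; apply: measurable_funB; exact: measurable_funM.
have iexp (y : 'rV[R]_n) : y != 0 ->
    (\int[leb]_t (expR (s * t - dotp y y * expR t))%:E)%E =
    (Gamma s * enorm y `^ (- (2 * s)))%:E.
  move=> y0; rewrite (integral_gamma_exp_scale s0 (dotp_gt0 y0)).
  by rewrite enorm_powR; congr (_ * _ `^ _)%:E; lra.
have igG := integrableZl measurableT (Gamma s) ig.
have mk : measurable_fun setT (fun xi : T n =>
    Gamma s * (enorm (row_of_tuple xi) `^ (- (2 * s)) * A xi)).
  by apply: measurable_funM => //; exact: measurable_funM.
have Fg : {ae mu n, forall xi, (\int[leb]_t `|(F (xi, t))%:E| <= (Gamma s * g xi)%:E)%E}.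
  apply: filterS aeN => xi y0.
  under eq_integral => t _ do rewrite /F/= normrM EFinM ger0_norm ?expR_ge0//.
  rewrite ge0_integralZr//; last by apply/measurable_EFinP; exact: mexp.
  by rewrite (iexp _ y0) -EFinM lee_fin -mulrA ler_wpM2l.
have Fk : {ae mu n, forall xi, (\int[leb]_t (F (xi, t))%:E)%E =
    (Gamma s * (enorm (row_of_tuple xi) `^ (- (2 * s)) * A xi))%:E}.
  apply: filterS aeN => xi y0.
  under eq_integral => t _ do rewrite /F/= EFinM.
  rewrite integralZr//; first by rewrite (iexp _ y0) -EFinM mulrA.
  apply: (@ge0_integrable_EFin _ (measurableTypeR R) _ leb _ _ _ _ (iexp _ y0)) => //.
  exact: mexp.
have [_ _ H3] := @fubini_ae _ _ (T n) (measurableTypeR R) R (mu n) leb F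
  _ _ mF mk igG Fg Fk.
rewrite -H3; apply: eq_integral => t _; exact/esym/int_gauss_phase.
Qed.

Lemma sqrt_pi_powR : Num.sqrt pi ^+ n * (4 * pi) `^ (n%:R / 2) = (2 * pi) ^+ n :> R.
Proof.
have p0 : 0 <= pi :> R by exact: pi_ge0.
have -> : (4 * pi) `^ (n%:R / 2) = Num.sqrt (4 * pi) ^+ n :> R.
  by rewrite [n%:R / 2]mulrC powRrM powR12_sqrt ?mulr_ge0// powR_mulrn ?sqrtr_ge0.
rewrite -exprMn sqrtrM// (_ : 4 = 2 ^+ 2) ?sqrtr_sqr; last by rewrite -natrX.
by rewrite ger0_norm// mulrCA -expr2 sqr_sqrtr.
Qed.

Lemma riesz_representation :
  \int[mu n]_xi (enorm (row_of_tuple xi) `^ (- (2 * s)) * A xi) =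
  (2 * pi) ^+ n * cos a *
    \int[mu n]_z (kernel_K s (x - row_of_tuple z) * u (row_of_tuple z)).
Proof.
have [_ iH H] := kernel_side x n0 mu_u u_rapid s0 sn u0.
have G0 : Gamma s != 0 by rewrite gt_eqF// Gamma_gt0.
apply: (mulfI G0); rewrite -(RintegralZl (Gamma s) measurableT integrable_multiplier).
have := congr1 fine spectral_side.
rewrite -[fine (\int[mu n]_xi _)%E]/(\int[mu n]_xi (Gamma s *
  (enorm (row_of_tuple xi) `^ (- (2 * s)) * A xi))) => <-.
rewrite -[LHS]/(\int[leb]_t (cos a * Num.sqrt pi ^+ n * heat_int x u s t)).
rewrite RintegralZl// H -sqrt_pi_powR; ring.
Qed.

End spectral_representation.

Local Open Scope complex_scope.

(** * Real and imaginary parts *)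
Section complex_assembly.
Context {R : realType}.
Local Notation mu n := (lebesgue_tuple R n).
Local Notation T n := (n.-tuple (measurableTypeR R)).
Local Notation Re := (@complex.Re R).
Local Notation Im := (@complex.Im R).

Lemma Re_realM (k : R) (w : R[i]) : Re (k%:C * w) = k * Re w.
Proof. by case: w => a b /=; rewrite mul0r subr0. Qed.

Lemma Im_realM (k : R) (w : R[i]) : Im (k%:C * w) = k * Im w.
Proof. by case: w => a b /=; rewrite mul0r addr0. Qed.

Lemma Re_integral_Rn n (g : 'rV[R]_n -> R[i]) :
  Re (integral_Rn g) = \int[mu n]_z Re (g (row_of_tuple z)).
Proof. by []. Qed.

Lemma Im_integral_Rn n (g : 'rV[R]_n -> R[i]) :
  Im (integral_Rn g) = \int[mu n]_z Im (g (row_of_tuple z)).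
Proof. by []. Qed.

Lemma Re_expiM (t : R) (w : R[i]) : Re (expi t * w) = cos t * Re w - sin t * Im w.
Proof. by case: w. Qed.

Lemma Im_expiM (t : R) (w : R[i]) : Im (expi t * w) = cos t * Im w + sin t * Re w.
Proof. by case: w. Qed.

Lemma abs_Re_le_normc (w : R[i]) : `|Re w| <= Normc.normc w.
Proof.
by case: w => a b /=; rewrite -sqrtr_sqr ler_wsqrtr// lerDl sqr_ge0.
Qed.

Lemma abs_Im_le_normc (w : R[i]) : `|Im w| <= Normc.normc w.
Proof.
by case: w => a b /=; rewrite -sqrtr_sqr ler_wsqrtr// lerDr sqr_ge0.
Qed.

Lemma Re_partials n (beta : seq 'I_n) (f : 'rV[R]_n -> R[i]) :
  Re \o partials beta f = rpartials beta (Re \o f).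
Proof.
elim: beta => [//|i beta IH]; apply/funext => y /=.
by rewrite /partial_derive /= -/(partials beta f) IH.
Qed.

Lemma Im_partials n (beta : seq 'I_n) (f : 'rV[R]_n -> R[i]) :
  Im \o partials beta f = rpartials beta (Im \o f).
Proof.
elim: beta => [//|i beta IH]; apply/funext => y /=.
by rewrite /partial_derive /= -/(partials beta f) IH.
Qed.

Lemma rschwartz_Re n (f : 'rV[R]_n -> R[i]) : schwartz f -> rschwartz (Re \o f).
Proof.
move=> [fs fM]; split=> [beta|beta i y|alpha beta].
- by rewrite -Re_partials; have [] := fs beta.
- by rewrite -Re_partials; have [_ _ /(_ i y)[]] := fs beta.
- have [M hM] := fM alpha beta; exists M => y; apply: le_trans (hM y).
  by rewrite -Re_partials ler_wpM2l// abs_Re_le_normc.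
Qed.

Lemma rschwartz_Im n (f : 'rV[R]_n -> R[i]) : schwartz f -> rschwartz (Im \o f).
Proof.
move=> [fs fM]; split=> [beta|beta i y|alpha beta].
- by rewrite -Im_partials; have [] := fs beta.
- by rewrite -Im_partials; have [_ _ /(_ i y)[]] := fs beta.
- have [M hM] := fM alpha beta; exists M => y; apply: le_trans (hM y).
  by rewrite -Im_partials ler_wpM2l// abs_Im_le_normc.
Qed.

Section phases.
Variables (n : nat) (x xi : 'rV[R]_n) (u v : 'rV[R]_n -> R).
Hypotheses (su : rschwartz u) (sv : rschwartz v).

Let iP (b : R -> R) (w : 'rV[R]_n -> R) : rschwartz w ->
  measurable_fun setT b -> (forall r, `|b r| <= 1) ->
  (mu n).-integrable setT (EFin \o (fun z =>
    b (- dotp (row_of_tuple z) xi) * w (row_of_tuple z))).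
Proof.
move=> sw mb b1; have := @integrable_phase R n 0 w
  (@rschwartz_measurable R n w [::] sw) (@rschwartz_rapid R n w [::] sw) b xi mb b1.
rewrite (_ : (fun z => _) = (fun z : T n =>
  b (- dotp (row_of_tuple z) xi) * w (row_of_tuple z)))//.
by apply/funext => z; rewrite sub0r -scaleN1r dotpZl mulN1r.
Qed.

Let ic w (sw : rschwartz w) := iP sw measurable_cosR norm_cos_le1.
Let is_ w (sw : rschwartz w) := iP sw measurable_sinR norm_sin_le1.
Let i1 := integrableB measurableT (ic su) (is_ sv).
Let i2 := integrableD measurableT (ic sv) (is_ su).

Let iph w b : rschwartz w -> (mu n).-integrable setT (EFin \o (fun z =>
    cos (dotp (x - row_of_tuple z) xi + b) * w (row_of_tuple z))).
Proof.
move=> sw; apply: integrable_phase_ft.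
- exact: (@rschwartz_measurable R n w [::] sw).
- exact: (@rschwartz_rapid R n w [::] sw).
Qed.

Let dotpB (z : T n) :
  dotp (x - row_of_tuple z) xi = dotp x xi + (- dotp (row_of_tuple z) xi).
Proof. by rewrite dotpDl -scaleN1r dotpZl mulN1r. Qed.

Lemma phase_ft_Re :
  cos (dotp x xi) * \int[mu n]_z (cos (- dotp (row_of_tuple z) xi) * u (row_of_tuple z) -
     sin (- dotp (row_of_tuple z) xi) * v (row_of_tuple z)) -
  sin (dotp x xi) * \int[mu n]_z (cos (- dotp (row_of_tuple z) xi) * v (row_of_tuple z) +
     sin (- dotp (row_of_tuple z) xi) * u (row_of_tuple z)) =
  phase_ft x 0 u xi + phase_ft x (pi / 2) v xi.
Proof.
rewrite -(RintegralZl _ measurableT i1) -(RintegralZl _ measurableT i2).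
rewrite -RintegralB//; last 2 first.
- exact: (integrableZl measurableT (cos (dotp x xi)) i1).
- exact: (integrableZl measurableT (sin (dotp x xi)) i2).
rewrite /phase_ft -(RintegralD measurableT (iph 0 su) (iph (pi / 2) sv)).
apply: eq_Rintegral => z _ /=; rewrite addr0 cosDpihalf dotpB cosD sinD; ring.
Qed.

Lemma phase_ft_Im :
  cos (dotp x xi) * \int[mu n]_z (cos (- dotp (row_of_tuple z) xi) * v (row_of_tuple z) +
     sin (- dotp (row_of_tuple z) xi) * u (row_of_tuple z)) +
  sin (dotp x xi) * \int[mu n]_z (cos (- dotp (row_of_tuple z) xi) * u (row_of_tuple z) -
     sin (- dotp (row_of_tuple z) xi) * v (row_of_tuple z)) =
  phase_ft x 0 v xi + phase_ft x (- (pi / 2)) u xi.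
Proof.
rewrite -(RintegralZl _ measurableT i1) -(RintegralZl _ measurableT i2).
rewrite -RintegralD//; last 2 first.
- exact: (integrableZl measurableT (cos (dotp x xi)) i2).
- exact: (integrableZl measurableT (sin (dotp x xi)) i1).
rewrite /phase_ft -(RintegralD measurableT (iph 0 sv) (iph (- (pi / 2)) su)).
apply: eq_Rintegral => z _ /=.
by rewrite addr0 cosB cos_pihalf sin_pihalf dotpB cosD sinD; ring.
Qed.

End phases.

(** In [riesz_representation] the phase [b] contributes cos b = 0. *)
Lemma Rintegral_riesz_split n (x : 'rV[R]_n) (u v : 'rV[R]_n -> R) (s c b : R) :
  (0 < n)%N -> cos b = 0 -> rschwartz u -> rschwartz v -> 0 < s -> s <= n%:R / 2 ->
  (s = n%:R / 2 -> \int[mu n]_z u (row_of_tuple z) = 0) ->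
  (s = n%:R / 2 -> \int[mu n]_z v (row_of_tuple z) = 0) ->
  \int[mu n]_xi (enorm (row_of_tuple xi) `^ (- (2 * s)) * (c *
    (phase_ft x 0 u (row_of_tuple xi) + phase_ft x b v (row_of_tuple xi)))) =
  c * (2 * pi) ^+ n *
    \int[mu n]_z (kernel_K s (x - row_of_tuple z) * u (row_of_tuple z)).
Proof.
move=> n0 b0 su sv s0 sn u0 v0.
have i1 := integrable_multiplier x 0 n0 su s0 sn u0.
have i2 := integrable_multiplier x b n0 sv s0 sn v0.
have i12 := integrableD measurableT i1 i2.
transitivity (\int[mu n]_xi (c * (enorm (row_of_tuple xi) `^ (- (2 * s)) *
    phase_ft x 0 u (row_of_tuple xi) + enorm (row_of_tuple xi) `^ (- (2 * s)) *
    phase_ft x b v (row_of_tuple xi)))).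
  by apply: eq_Rintegral => xi _; ring.
rewrite (RintegralZl c measurableT i12) (RintegralD measurableT i1 i2).
rewrite (riesz_representation x 0 n0 su s0 sn u0).
rewrite (riesz_representation x b n0 sv s0 sn v0).
by rewrite cos0 b0; ring.
Qed.

Lemma fourier_norm_sqr n :
  (2 * pi) `^ (- (n%:R / 2)) * ((2 * pi) `^ (- (n%:R / 2)) * (2 * pi) ^+ n) = 1 :> R.
Proof.
have p0 : 0 < 2 * pi :> R by rewrite mulr_gt0 ?pi_gt0.
rewrite -(powR_mulrn n (ltW p0)) mulrA -powRD ?(gt_eqF p0) ?implybT//.
rewrite -powRD ?(gt_eqF p0) ?implybT// (_ : _ + n%:R = 0) ?powRr0//.
by lra.
Qed.

End complex_assembly.

Unset Implicit Arguments.

Theorem theorem5 (R : realType) (n : nat) (f : 'rV[R]_n -> R[i])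
    (x : 'rV[R]_n) (s : R) :
  (1 <= n)%N -> schwartz f -> 0 < s -> s <= n%:R / 2 ->
  (s = n%:R / 2 -> integral_Rn f = 0) ->
  integrable_Rn (fun z => (kernel_K s (x - z))%:C * f z) /\
  inv_frac_laplacian s f x =
    integral_Rn (fun z => (kernel_K s (x - z))%:C * f z).
Proof.
move=> n1 sf s0 sn f0.
pose u := @complex.Re R \o f; pose v := @complex.Im R \o f.
have su : rschwartz u by exact: rschwartz_Re.
have sv : rschwartz v by exact: rschwartz_Im.
have u0 : s = n%:R / 2 -> \int[lebesgue_tuple R n]_z u (row_of_tuple z) = 0.
  by move=> /f0 /(congr1 (@complex.Re R)).
have v0 : s = n%:R / 2 -> \int[lebesgue_tuple R n]_z v (row_of_tuple z) = 0.
  by move=> /f0 /(congr1 (@complex.Im R)).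
have [iu _ _] := kernel_side x n1 (@rschwartz_measurable R n u [::] su)
  (@rschwartz_rapid R n u [::] su) s0 sn u0.
have [iv _ _] := kernel_side x n1 (@rschwartz_measurable R n v [::] sv)
  (@rschwartz_rapid R n v [::] sv) s0 sn v0.
split.
  split.
    by under eq_fun do rewrite Re_realM.
  by under eq_fun do rewrite Im_realM.
pose c : R := (2 * pi) `^ (- (n%:R / 2)).
have cc : c * (c * (2 * pi) ^+ n) = 1 by exact: fourier_norm_sqr.
have ReE xi : @complex.Re R (expi (dotp x xi) *
    ((enorm xi `^ (- (2 * s)))%:C * fourier f xi)) = enorm xi `^ (- (2 * s)) *
    (c * (phase_ft x 0 u xi + phase_ft x (pi / 2) v xi)).
  rewrite -(phase_ft_Re x xi su sv) Re_expiM Re_realM Im_realM.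
  rewrite /fourier Re_realM Im_realM /integral_Rn /=.
  under eq_Rintegral do rewrite Re_expiM.
  under [X in _ - _ * (_ * (_ * X))]eq_Rintegral do rewrite Im_expiM.
  by rewrite -/c; ring.
have ImE xi : @complex.Im R (expi (dotp x xi) *
    ((enorm xi `^ (- (2 * s)))%:C * fourier f xi)) = enorm xi `^ (- (2 * s)) *
    (c * (phase_ft x 0 v xi + phase_ft x (- (pi / 2)) u xi)).
  rewrite -(phase_ft_Im x xi su sv) Im_expiM Re_realM Im_realM.
  rewrite /fourier Re_realM Im_realM /integral_Rn /=.
  under eq_Rintegral do rewrite Im_expiM.
  under [X in _ + _ * (_ * (_ * X))]eq_Rintegral do rewrite Re_expiM.
  by rewrite -/c; ring.
apply/eqP; rewrite eq_complex; apply/andP; split; apply/eqP.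
- rewrite /inv_frac_laplacian /inverse_fourier Re_realM !Re_integral_Rn.
  under eq_Rintegral do rewrite ReE.
  under [RHS]eq_Rintegral do rewrite Re_realM.
  rewrite (Rintegral_riesz_split x c n1 (@cos_pihalf R) su sv s0 sn u0 v0).
  by rewrite mulrA -/c cc mul1r.
- rewrite /inv_frac_laplacian /inverse_fourier Im_realM !Im_integral_Rn.
  under eq_Rintegral do rewrite ImE.
  under [RHS]eq_Rintegral do rewrite Im_realM.
  have cN : cos (- (pi / 2)) = 0 :> R by rewrite cosN cos_pihalf.
  rewrite (Rintegral_riesz_split x c n1 cN sv su s0 sn v0 u0).
  by rewrite mulrA -/c cc mul1r.
Qed.
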